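(* Let $T\simeq(\mathbb{C}^* )^r$ be a complex torus with character group $\Lambda$, fix primitive characters $\chi_1,\dots,\chi_n\in\Lambda$, put $E=\{1,\dots,n\}$, and let $\mathscr{S}$ be a poset over $E$. The subset of $(\mathbb{C}^* )^n$ given by $$L(\mathscr{S})=\{\underline{a}=(a_i)_i\in(\mathbb{C}^* )^n\mid\mathscr{S}(\{(a_i,\chi_i)\}_{i=1,\dots,n})\simeq\mathscr{S}\}$$ is a smooth locally closed subset of $(\mathbb{C}^* )^n$. Moreover, if $\mathscr{S}$ is nearly generic then $L(\mathscr{S})$ is connected or empty.
   Context: A character is primitive if it is nonzero and not a nontrivial integer multiple of an element of $\Lambda$. For $\underline a\in(\mathbb{C}^* )^n$ the toric arrangement $\{(a_i,\chi_i)\}_{i=1,\dots,n}$ has the (connected) hypertori $H_i(\underline a)=\{t\in T:a_i\chi_i(t)=1\}$. Its poset of layers $\mathscr{S}(\{(a_i,\chi_i)\}_i)$ is the set of connected components of nonempty intersections of hypertori ($T$ included), ordered by reverse inclusion and ranked by codimension. It comes with the natural surjection $i\mapsto H_i$ from $E$ onto its set of atoms (rank-one elements); thus it is a poset over $E$, and $\simeq$ means isomorphism of posets compatible with the maps from $E$ to the sets of atoms. A layer $W$ is generic if there are exactly $\operatorname{rk}W$ hypertori of the arrangement (counted as indices $i\in E$) containing $W$, i.e. exactly $\operatorname{rk}W$ indices whose atom is $\le W$ in $\mathscr{S}$. A poset $\mathscr{S}$ is nearly generic if there exists a layer $\overline{W}\in\mathscr{S}$ such that all layers $W$ not containing $\overline{W}$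 (i.e. $W\not\le\overline{W}$ in $\mathscr{S}$) are generic. ''Locally closed'' refers to the Zariski topology. *)

(* Defs.v *)
From HB Require Import structures.
From mathcomp Require Import all_boot all_order all_algebra.
From mathcomp Require Import complex.
From mathcomp Require Import boolp classical_sets functions reals topology.
From mathcomp Require Import mpoly.

Set Implicit Arguments.
Unset Strict Implicit.
Unset Printing Implicit Defensive.

Import Order.TTheory GRing.Theory Num.Theory.
Local Open Scope ring_scope.
Local Open Scope classical_set_scope.

(* The algebraic torus (F\{0})^n.  It is used both for T = (F\{0})^r and for the
   parameter space (F\{0})^n of the translations a. *)
Record torus (F : fieldType) (n : nat) := Torus {
  tcoord :> {ffun 'I_n -> F};
  tcoord_neq0 : [forall i, tcoord i != 0]
}.

HB.instance Definition _ (F : fieldType) n := [isSub for @tcoord F n].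
HB.instance Definition _ (F : fieldType) n := [Choice of torus F n by <:].

Section Zariski.
Variables (F : fieldType) (n : nat).

(* The torus carries the Zariski topology, which is the one used below for
   connectedness and connected components as well as for local closedness; over
   the complex numbers a locally closed set is connected in this topology iff it
   is in the Euclidean one.
   Ordinary polynomials suffice: on the torus every Laurent polynomial is a
   polynomial times an invertible monomial. *)
Definition zero_locus (P : set {mpoly F[n]}) : set (torus F n) :=
  [set x | forall p, P p -> p.@[x] = 0].

Definition zariski_open (U : set (torus F n)) : Prop :=
  exists P, U = ~` zero_locus P.

Fact zariski_openT : zariski_open [set: torus F n].
Proof.
exists [set 1]; apply/seteqP; split=> // x _ /(_ 1 erefl).
by rewrite meval1 => /eqP; rewrite oner_eq0.
Qed.

Fact zariski_openI : setI_closed zariski_open.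
Proof.
move=> _ _ [P ->] [Q ->].
exists [set pq | exists p q, [/\ P p, Q q & pq = p * q]].
rewrite -setCU; congr (~` _); apply/seteqP; split=> x /=.
  case=> zx _ [p [q [Pp Qq ->]]]; rewrite mevalM.
    by rewrite (zx p) ?mul0r.
  by rewrite (zx q) ?mulr0.
move=> zx; apply: contrapT => /not_orP[]; rewrite /zero_locus /=.
move=> /existsNP[p /not_implyP[Pp /eqP px]].
move=> /existsNP[q /not_implyP[Qq /eqP qx]].
have /zx : exists p' q', [/\ P p', Q q' & p * q = p' * q'] by exists p, q.
by rewrite mevalM => /eqP; rewrite mulf_eq0 (negPf px) (negPf qx).
Qed.

Fact zariski_open_bigU (I : Type) (U : I -> set (torus F n)) :
  (forall i, zariski_open (U i)) -> zariski_open (\bigcup_i U i).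
Proof.
move=> /choice[P UE]; exists (\bigcup_i P i).
have -> : U = fun i => ~` zero_locus (P i) by apply/funext.
rewrite -setC_bigcap; congr (~` _); apply/seteqP; split=> x /= zx.
  by move=> p [i _ Pp]; apply: (zx i).
by move=> i _ p Pp; apply: zx; exists i.
Qed.

HB.instance Definition _ := isOpenTopological.Build (torus F n)
  zariski_openT zariski_openI zariski_open_bigU.

(* X (a locally closed subset, with its reduced structure) is smooth at a if, on
   some principal neighbourhood D(h) of a, it is the scheme of zeros of c
   polynomials whose differentials at a are linearly independent.  The third
   clause says that the f k generate the whole ideal of X on D(h), i.e. after
   inverting h. *)
Definition smooth_at (X : set (torus F n)) (a : torus F n) : Prop :=
  exists (h : {mpoly F[n]}) (c : nat) (f : 'I_c -> {mpoly F[n]}),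
  [/\ h.@[a] != 0,
      forall x : torus F n, h.@[x] != 0 ->
        (X x <-> forall k, (f k).@[x] = 0),
      forall p : {mpoly F[n]},
        (forall x : torus F n, X x -> h.@[x] != 0 -> p.@[x] = 0) ->
        exists (N : nat) (q : 'I_c -> {mpoly F[n]}),
          h ^+ N * p = \sum_(k < c) q k * f k
    & row_free (\matrix_(k < c, j < n) ((f k)^`M(j)).@[a])].

Definition smooth_subset (X : set (torus F n)) : Prop :=
  forall a, X a -> smooth_at X a.

End Zariski.

Definition locally_closed (X : topologicalType) (A : set X) : Prop :=
  exists U Z : set X, [/\ open U, closed Z & A = U `&` Z].

Section Characters.
Variables (F : fieldType) (r : nat).

(* The character group of (F\{0})^r is identified with Z^r. *)
Definition chareval (chi : 'rV[int]_r) (t : torus F r) : F :=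
  \prod_(j < r) t j ^ chi 0 j.

Definition primitive_char (chi : 'rV[int]_r) : Prop :=
  chi != 0 /\
  forall (k : int) (lam : 'rV[int]_r), chi = k *: lam -> k = 1 \/ k = -1.

Variables (n : nat) (chi : 'I_n -> 'rV[int]_r).

Definition hypertorus (a : torus F n) (i : 'I_n) : set (torus F r) :=
  [set t | a i * chareval (chi i) t = 1].

Definition hypertori_inter (a : torus F n) (I : {set 'I_n}) :
    set (torus F r) :=
  [set t | forall i, i \in I -> hypertorus a i t].

(* The elements of the poset of layers, ordered by reverse inclusion; I = set0
   gives T itself. *)
Definition layers (a : torus F n) : set (set (torus F r)) :=
  [set W | exists (I : {set 'I_n}) (t : torus F r),
     hypertori_inter a I t /\ W = connected_component (hypertori_inter a I) t].

End Characters.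

(* A poset over E: a ranked poset with a surjection from E onto its rank-one
   elements.  The axioms on po_rank characterize it uniquely on a finite poset;
   on the poset of layers it is the codimension. *)
Record posetOver (E : finType) := PosetOver {
  po_disp : Order.disp_t;
  po_sort :> porderType po_disp;
  po_rank : po_sort -> nat;
  po_atom : E -> po_sort;
  po_rank_min : forall x, (forall y, ~~ (y < x)%O) -> po_rank x = 0%N;
  po_rank_lt : forall x y, (x < y)%O -> (po_rank x < po_rank y)%N;
  po_rank_cover : forall x y, (x < y)%O ->
    (forall z, ~~ ((x < z)%O && (z < y)%O)) -> po_rank y = (po_rank x).+1;
  po_atom_rank : forall e, po_rank (po_atom e) = 1%N;
  po_atom_surj : forall x, po_rank x = 1%N -> exists e, po_atom e = x
}.

Section PosetOver.
Variables (E : finType) (S : posetOver E).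

Definition generic_layer (W : S) : Prop :=
  #|[set e : E | (po_atom S e <= W)%O]%SET| = po_rank W.

Definition nearly_generic : Prop :=
  exists Wbar : S, forall W : S, ~~ (W <= Wbar)%O -> generic_layer W.

End PosetOver.

(* The poset of layers of {(a i, chi i)}, with i |-> H_i, is isomorphic to S as
   a poset over 'I_n. *)
Definition layers_iso (F : fieldType) (r n : nat) (chi : 'I_n -> 'rV[int]_r)
    (a : torus F n) (S : posetOver 'I_n) : Prop :=
  exists phi : S -> set (torus F r),
  [/\ set_bij [set: S] (layers chi a) phi,
      forall x y : S, (x <= y)%O <-> phi y `<=` phi x
    & forall i : 'I_n, phi (po_atom S i) = hypertorus chi a i].

Definition Lset (F : fieldType) (r n : nat) (chi : 'I_n -> 'rV[int]_r)
    (S : posetOver 'I_n) : set (torus F n) :=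
  [set a | layers_iso chi a S].

Arguments Lset F {r n} chi S.

(* Main.v *)
(* Write x^m for the value at x of the character m. The hypertori indexed by I
   meet exactly when a^m = 1 for every integer relation m between the chi_i,
   i in I (divisibility of the torus). The poset S determines which families I
   are central, i.e. meet; let Lambda be the saturation of the lattice spanned by
   the relations of the central families, and C_a the coset of a under the
   subtorus on which Lambda is trivial. Two facts give everything.

   (1) If a lies in L(S), x lies in C_a and no non-central family meets at x,
   then x lies in L(S): write x = a y^B with B an integer matrix killed by the
   relations; for each central I solve chi_I w_I = - N B_I over the integers, take
   u with u^N = y, and send a layer W to u^(w_I) W, where I indexes the hypertori
   containing W. Two choices of w_I differ by an element of the identity component
   of the common kernel of the chi_i, which stabilises W, so this map is an
   isomorphism of posets.

   (2) On L(S) the characters of Lambda are torsion, so near a the set L(S) agrees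
   with C_a; hence it is locally closed, and smooth because C_a is cut out by
   binomials x^(m+) = a^m x^(m-), m in a basis of Lambda: they generate the ideal
   because distinct characters are linearly independent.

   If S is nearly generic, a layer not containing Wbar has independent characters,
   so every relation is supported on the hypertori containing Wbar. Those
   form a central family, whose relations are already saturated, so L(S) is an
   open subset of the irreducible set C_a. *)
Require Import Defs.
From mathcomp Require Import all_boot all_order all_algebra.
From mathcomp Require Import complex.
From mathcomp Require Import boolp classical_sets functions reals topology.
From mathcomp Require Import mpoly.
From mathcomp Require Import ring zify.

Import Order.TTheory GRing.Theory Num.Theory.
Local Open Scope ring_scope.
Local Open Scope classical_set_scope.

Set Implicit Arguments.
Unset Strict Implicit.
Unset Printing Implicit Defensive.

(** * Monomial maps between tori *)

Section TorusGroup.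
Variable F : fieldType.

Lemma tneq0 n (t : torus F n) i : t i != 0.
Proof. by case: t => t /= /forallP. Qed.

Lemma torus_eq n (s t : torus F n) : (forall i, s i = t i) -> s = t.
Proof. by move=> st; apply/val_inj/ffunP. Qed.

Lemma tmk_subproof n (f : 'I_n -> F) :
  [forall i, [ffun i => if f i == 0 then 1 else f i] i != 0].
Proof. by apply/forallP => i; rewrite ffunE; case: ifPn => // _; apply: oner_neq0. Qed.

(* Zero coordinates are replaced by [1] to make the construction total. *)
Definition tmk n (f : 'I_n -> F) : torus F n := Torus (tmk_subproof f).

Lemma tmkE n (f : 'I_n -> F) i : f i != 0 -> tmk f i = f i.
Proof. by move=> fi; rewrite ffunE (negPf fi). Qed.

Definition tmul n (s t : torus F n) := tmk (fun i => s i * t i).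
Definition tinv n (t : torus F n) := tmk (fun i => (t i)^-1).
Definition tone n : torus F n := tmk (fun=> 1).

Lemma tmulE n (s t : torus F n) i : tmul s t i = s i * t i.
Proof. by rewrite tmkE// mulf_neq0 ?tneq0. Qed.

Lemma tinvE n (t : torus F n) i : tinv t i = (t i)^-1.
Proof. by rewrite tmkE// invr_neq0 ?tneq0. Qed.

Lemma toneE n i : tone n i = 1.
Proof. by rewrite tmkE// oner_neq0. Qed.

Lemma tmulA n : associative (@tmul n).
Proof. by move=> x y z; apply: torus_eq => i; rewrite !tmulE mulrA. Qed.

Lemma tmulC n : commutative (@tmul n).
Proof. by move=> x y; apply: torus_eq => i; rewrite !tmulE mulrC. Qed.

Lemma tmul1 n : left_id (tone n) (@tmul n).
Proof. by move=> x; apply: torus_eq => i; rewrite !tmulE toneE mul1r. Qed.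

Lemma tmulV n (x : torus F n) : tmul (tinv x) x = tone n.
Proof.
by apply: torus_eq => i; rewrite !tmulE tinvE toneE mulVf ?tneq0.
Qed.

Lemma tinvK n : involutive (@tinv n).
Proof. by move=> x; apply: torus_eq => i; rewrite !tinvE invrK. Qed.

Lemma tmulKV n (x y : torus F n) : tmul (tinv x) (tmul x y) = y.
Proof. by rewrite tmulA tmulV tmul1. Qed.

Lemma tmulVK n (x y : torus F n) : tmul x (tmul (tinv x) y) = y.
Proof. by rewrite tmulA [tmul x _]tmulC tmulV tmul1. Qed.

Lemma chareval_neq0 r (m : 'rV[int]_r) (t : torus F r) : chareval m t != 0.
Proof. by apply/prodf_neq0 => i _; rewrite expfz_neq0 ?tneq0. Qed.

Lemma chareval0 r (t : torus F r) : chareval 0 t = 1.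
Proof. by rewrite /chareval big1// => i _; rewrite mxE expr0z. Qed.

Lemma charevalD r (m m' : 'rV[int]_r) (t : torus F r) :
  chareval (m + m') t = chareval m t * chareval m' t.
Proof.
by rewrite -big_split; apply: eq_bigr => i _; rewrite mxE expfzDr ?tneq0.
Qed.

Lemma charevalZ r k (m : 'rV[int]_r) (t : torus F r) :
  chareval (k *: m) t = chareval m t ^ k.
Proof.
rewrite /chareval (big_morph (fun x : F => x ^ k) (id1 := 1) (op1 := *%R)).
- by apply: eq_bigr => i _; rewrite mxE exprz_exp mulrC.
- by move=> x y; rewrite expfzMl.
- by rewrite exp1rz.
Qed.

Lemma charevalN r (m : 'rV[int]_r) (t : torus F r) :
  chareval (- m) t = (chareval m t)^-1.
Proof. by rewrite -scaleN1r charevalZ exprN1. Qed.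

Lemma chareval_sum r (I : Type) (s : seq I) (P : pred I) (m : I -> 'rV[int]_r)
    (t : torus F r) :
  chareval (\sum_(i <- s | P i) m i) t = \prod_(i <- s | P i) chareval (m i) t.
Proof.
by apply: (big_morph (fun m => chareval m t)) => [x y|]; rewrite ?charevalD ?chareval0.
Qed.

Lemma charevalM r (m : 'rV[int]_r) (s t : torus F r) :
  chareval m (tmul s t) = chareval m s * chareval m t.
Proof.
by rewrite -big_split; apply: eq_bigr => i _; rewrite tmulE expfzMl.
Qed.

Lemma chareval_inv r (m : 'rV[int]_r) (t : torus F r) :
  chareval m (tinv t) = (chareval m t)^-1.
Proof.
apply: (mulIf (chareval_neq0 m t)); rewrite -charevalM tmulV mulVf ?chareval_neq0//.
by rewrite /chareval big1// => i _; rewrite toneE exp1rz.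
Qed.

Lemma chareval_delta r (j : 'I_r) (t : torus F r) : chareval (delta_mx 0 j) t = t j.
Proof.
rewrite /chareval (bigD1 j)//= big1 ?mulr1 => [|i ij].
  by rewrite mxE !eqxx expr1z.
by rewrite mxE (negPf ij) andbF expr0z.
Qed.

Definition tmap p q (A : 'M[int]_(p, q)) (t : torus F q) : torus F p :=
  tmk (fun i => chareval (row i A) t).

Lemma tmapE p q (A : 'M[int]_(p, q)) (t : torus F q) i :
  tmap A t i = chareval (row i A) t.
Proof. by rewrite tmkE// chareval_neq0. Qed.

Lemma chareval_tmap p q m (A : 'M[int]_(p, q)) (t : torus F q) :
  chareval m (tmap A t) = chareval (m *m A) t.
Proof.
rewrite mulmx_sum_row chareval_sum; apply: eq_bigr => i _.
by rewrite charevalZ tmapE.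
Qed.

Lemma tmap_inv p q (A : 'M[int]_(p, q)) (t : torus F q) :
  tmap A (tinv t) = tinv (tmap A t).
Proof. by apply: torus_eq => i; rewrite tinvE !tmapE chareval_inv. Qed.

Lemma tmapM p q l (A : 'M[int]_(p, q)) (B : 'M_(q, l)) (t : torus F l) :
  tmap A (tmap B t) = tmap (A *m B) t.
Proof. by apply: torus_eq => i; rewrite !tmapE chareval_tmap row_mul. Qed.

Lemma tmapB p q (A B : 'M[int]_(p, q)) (t : torus F q) :
  tmap (A - B) t = tmul (tmap A t) (tinv (tmap B t)).
Proof.
by apply: torus_eq => i; rewrite tmulE tinvE !tmapE linearB charevalD charevalN.
Qed.

Lemma tmap1 q (t : torus F q) : tmap 1%:M t = t.
Proof. by apply: torus_eq => i; rewrite tmapE row1 chareval_delta. Qed.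

Lemma tmap_scalar q (k : int) (t : torus F q) i : tmap k%:M t i = t i ^ k.
Proof. by rewrite tmapE -scalemx1 linearZ/= row1 charevalZ chareval_delta. Qed.

End TorusGroup.

(** * Linear independence of multiplicative functions *)

Section Dedekind.
Variables (F : fieldType) (T : Type) (I : eqType) (op : T -> T -> T).
Variable chi : I -> T -> F.
Hypothesis chiM : forall i x y, chi i (op x y) = chi i x * chi i y.

(** Pick [x] separating [chi j] from [chi i0]. The relation at [op x y] minus [chi j x] times the
    relation at [y] loses the term [j] and multiplies [c0] by the nonzero factor
    [chi i0 x - chi j x]. *)
Lemma dedekind_independence (s : seq I) (i0 : I) (c0 : F) (c : I -> F) :
    {in s, forall j, exists x, chi j x != chi i0 x} ->
    (exists x, chi i0 x != 0) ->
    (forall x, c0 * chi i0 x + \sum_(i <- s) c i * chi i x = 0) ->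
  c0 = 0.
Proof.
elim: s c0 c => [|j s IHs] c0 c dist [x0 x0P] sum0.
  have := sum0 x0; rewrite big_nil addr0 => /eqP.
  by rewrite mulf_eq0 (negPf x0P) orbF => /eqP.
have [x xP] := dist j (mem_head j s).
have /eqP : c0 * (chi i0 x - chi j x) = 0.
  apply: (IHs _ (fun i => c i * (chi i x - chi j x))).
  - by move=> i is_; apply: dist; rewrite inE is_ orbT.
  - by exists x0.
  move=> y; rewrite (eq_bigr (fun i =>
      c i * chi i (op x y) - chi j x * (c i * chi i y))) => [|i _].
    rewrite sumrB -mulr_sumr.
    have := sum0 y; have := sum0 (op x y); rewrite !big_cons !chiM.
    move: (\sum_(i <- s) _) (\sum_(i <- s) _) => A B /eqP.
    rewrite addrA addrC addr_eq0 => /eqP-> /eqP.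
    rewrite addrA addrC addr_eq0 => /eqP->; ring.
  by rewrite chiM; ring.
by rewrite mulf_eq0 subr_eq0 [chi i0 x == _]eq_sym (negPf xP) orbF => /eqP.
Qed.

End Dedekind.

(** * The Zariski topology of a torus *)

Section Monomials.
Variable n : nat.

Definition mrow (al : 'X_{1..n}) : 'rV[int]_n := \row_j (al j)%:Z.
(** Positive and negative parts of an exponent vector: a character becomes a quotient of two honest
    monomials. *)
Definition mpos (m : 'rV[int]_n) : 'X_{1..n} := [multinom absz (Num.max (m 0 j) 0)%R | j < n].
Definition mneg (m : 'rV[int]_n) : 'X_{1..n} := mpos (- m).

Lemma mrowD al be : mrow (al + be) = mrow al + mrow be.
Proof. by apply/rowP => j; rewrite !mxE mnmDE PoszD. Qed.

Lemma mrow_inj : injective mrow.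
Proof. by move=> al be /rowP E; apply/mnmP => j; have := E j; rewrite !mxE => -[]. Qed.

Lemma mposBneg m : mrow (mpos m) - mrow (mneg m) = m.
Proof. by apply/rowP => j; rewrite !mxE !mnmE !mxE; move: (m 0 j) => k; rewrite /Num.max; case: ifP; case: ifP; lia. Qed.

Lemma mevalX_char (F : fieldType) (t : torus F n) al :
  'X_[al].@[t] = chareval (mrow al) t.
Proof. by rewrite mevalX; apply: eq_bigr => j _; rewrite mxE. Qed.

Lemma mevalE_char (F : fieldType) (t : torus F n) (p : {mpoly F[n]}) :
  p.@[t] = \sum_(al <- msupp p) p@_al * chareval (mrow al) t.
Proof.
rewrite mevalE; apply: eq_bigr => al _; congr (_ * _).
by rewrite -mevalX mevalX_char.
Qed.

End Monomials.

Section Laurent.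
Variables (F : fieldType) (n : nat).

(** The monomial [mu] clears denominators. It vanishes nowhere on the torus, so [phi] and [p] have
    the same zeros. *)
Definition laurent (phi : torus F n -> F) : Prop :=
  exists (mu : 'X_{1..n}) (p : {mpoly F[n]}),
    forall x : torus F n, p.@[x] = 'X_[mu].@[x] * phi x.

Lemma laurent_cst c : laurent (fun=> c).
Proof.
exists 0%MM, c%:MP => x; rewrite mevalC mevalX_char.
have -> : mrow (0%MM : 'X_{1..n}) = 0 by apply/rowP => j; rewrite !mxE mnm0E.
by rewrite chareval0 mul1r.
Qed.

Lemma laurentD phi psi : laurent phi -> laurent psi ->
  laurent (fun x => phi x + psi x).
Proof.
move=> [mu [p pP]] [nu [q qP]]; exists (mu + nu)%MM, (p * 'X_[nu] + q * 'X_[mu]).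
by move=> x; rewrite mpolyXD !(mevalD, mevalM) pP qP; ring.
Qed.

Lemma laurentM phi psi : laurent phi -> laurent psi ->
  laurent (fun x => phi x * psi x).
Proof.
move=> [mu [p pP]] [nu [q qP]]; exists (mu + nu)%MM, (p * q).
by move=> x; rewrite mpolyXD !mevalM pP qP; ring.
Qed.

Lemma laurent_sum I (s : seq I) (phi : I -> torus F n -> F) :
  (forall i, laurent (phi i)) -> laurent (fun x => \sum_(i <- s) phi i x).
Proof.
move=> phiP; elim: s => [|i s IHs].
  by under eq_fun do rewrite big_nil; apply: laurent_cst.
by under eq_fun do rewrite big_cons; apply: laurentD.
Qed.

Lemma laurent_char m : laurent (chareval m).
Proof.
exists (mneg m), 'X_[mpos m] => x.
rewrite !mevalX_char -charevalD; congr (chareval _ x).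
by apply/eqP; rewrite addrC -subr_eq mposBneg.
Qed.

Lemma laurentX phi k : laurent phi -> laurent (fun x => phi x ^+ k).
Proof.
move=> phiP; elim: k => [|k IHk]; first exact: laurent_cst.
by under eq_fun do rewrite exprS; apply: laurentM.
Qed.

Lemma openZE (U : set (torus F n)) : open U = zariski_open U.
Proof. by []. Qed.

Lemma closed_laurent phi : laurent phi -> closed [set x | phi x = 0].
Proof.
move=> [mu [p pP]]; rewrite -openC openZE; exists [set p].
congr (~` _); apply/seteqP; split=> x /=.
  by move=> x0 _ ->; rewrite pP x0 mulr0.
move=> /(_ p erefl) /eqP; rewrite pP mulf_eq0 mevalX_char.
by rewrite (negPf (chareval_neq0 _ _)) => /eqP.
Qed.

Lemma open_laurent phi : laurent phi -> open [set x | phi x != 0].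
Proof.
move=> /closed_laurent; rewrite -openC; congr (open _).
by apply/seteqP; split=> x /= /eqP.
Qed.

Lemma open_poly (U : set (torus F n)) a : open U -> U a ->
  exists h : {mpoly F[n]}, h.@[a] != 0 /\ forall x : torus F n, h.@[x] != 0 -> U x.
Proof.
rewrite openZE => -[P ->] /existsNP[h /not_implyP[Ph /eqP ha]].
exists h; split=> // x /eqP hx zx; exact/hx/zx.
Qed.

End Laurent.

Section MonomialMaps.
Variable F : fieldType.

(** Pulling a polynomial back along a monomial map gives a Laurent polynomial, whose zero set is
    closed. *)
Lemma monomial_continuous p q (A : 'M[int]_(p, q)) (a : torus F p) :
  continuous (fun x => tmul a (tmap A x)).
Proof.
apply/continuousP => U; rewrite openZE => -[P ->]; rewrite preimage_setC openC.
rewrite [X in closed X](_ : _ = \bigcap_(f in P) [set x | f.@[tmul a (tmap A x)] = 0]).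
  apply: closed_bigI => f _; apply: closed_laurent.
  under eq_fun do rewrite mevalE_char.
  apply: laurent_sum => al; apply: laurentM; first exact: laurent_cst.
  under eq_fun do rewrite charevalM chareval_tmap.
  by apply: laurentM; [apply: laurent_cst | apply: laurent_char].
by apply/seteqP; split=> x /= zx f; apply: zx.
Qed.

Lemma tmul_continuous p (a : torus F p) : continuous (tmul a).
Proof.
have := @monomial_continuous p p 1%:M a.
by rewrite (_ : (fun x => _) = tmul a)//; apply/funext => x; rewrite tmap1.
Qed.

End MonomialMaps.

Section Irreducible.
Variable T : topologicalType.

Definition irreducible_set (A : set T) : Prop :=
  forall U V : set T, open U -> open V ->
    A `&` U !=set0 -> A `&` V !=set0 -> A `&` (U `&` V) !=set0.

(** A proper nonempty clopen part and its complement would be disjoint nonempty relatively open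
    subsets. *)
Lemma irreducible_connected (A : set T) : irreducible_set A -> connected A.
Proof.
move=> irrA B [b Bb] [U oU BU] [C cC BC]; rewrite BC; apply/seteqP; split=> [x []//|x Ax].
split=> //; apply: contrapT => nCx.
have [||y [Ay [Uy nCy]]] := irrA U (~` C) oU (closed_openC cC).
- by exists b; rewrite -BU.
- by exists x.
have By : B y by rewrite BU.
by move: By; rewrite BC => -[].
Qed.

Lemma irreducible_setI (A U : set T) :
  irreducible_set A -> open U -> irreducible_set (A `&` U).
Proof.
move=> irrA oU V W oV oW [v [[Av Uv] Vv]] [w [[Aw Uw] Ww]].
have [||||x [Ax [[Ux Vx] [_ Wx]]]] := irrA (U `&` V) (U `&` W).
- exact: openI.
- exact: openI.
- by exists v.
- by exists w.
by exists x.
Qed.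

End Irreducible.

Lemma irreducible_image (S T : topologicalType) (f : S -> T) (A : set S) :
  continuous f -> irreducible_set A -> irreducible_set (f @` A).
Proof.
move=> /continuousP cf irrA U V /cf oU /cf oV [_ [[x Ax <-] Ux]] [_ [[y Ay <-] Vy]].
have [||z [Az [Uz Vz]]] := irrA _ _ oU oV; [by exists x|by exists y|].
by exists (f z); split; first exists z.
Qed.

Section TorusIrreducible.
Variable F : numFieldType.

Lemma char_sep n (m m' : 'rV[int]_n) : m != m' ->
  exists y : torus F n, chareval m y != chareval m' y.
Proof.
move=> /eqP mm'; have /existsNP[j /eqP mj] : ~ forall j, m 0 j = m' 0 j.
  by move=> E; apply/mm'/rowP.
(* Here a character takes the value 2 raised to its [j]-th exponent; the exponents are then compared
   inside the rationals. *)
exists (tmk (fun i => if i == j then 2 else 1)).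
have E k : chareval k (tmk (fun i => if i == j then 2 else 1)) = (2 : F) ^ k 0 j.
  rewrite /chareval (bigD1 j)//= big1 ?mulr1 => [|i ij].
    by rewrite tmkE eqxx// pnatr_eq0.
  by rewrite tmkE (negPf ij) ?exp1rz ?oner_neq0.
have E2 k : (2 : F) ^ k = ratr ((2 : rat) ^ k) by rewrite fmorphXz rmorph_nat.
by rewrite !E !E2; apply: contra mj => /eqP /fmorph_inj /ieexprIz ->.
Qed.

Lemma char_independence n (I : eqType) (s : seq I) (m : I -> 'rV[int]_n)
    (c : I -> F) (i0 : I) :
    uniq s -> i0 \in s -> {in s, forall i, i != i0 -> m i != m i0} ->
    (forall y : torus F n, \sum_(i <- s) c i * chareval (m i) y = 0) ->
  c i0 = 0.
Proof.
move=> us i0s ms sum0.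
apply: (@dedekind_independence F (torus F n) I (@tmul F n)
  (fun i => chareval (m i)) _ (rem i0 s) i0 (c i0) c).
- by move=> i x y; rewrite charevalM.
- move=> i; rewrite mem_rem_uniq// !inE => /andP[ii0 is_].
  exact/char_sep/ms.
- by exists (tone F n); rewrite chareval_neq0.
by move=> x; rewrite -[RHS](sum0 x) (perm_big _ (perm_to_rem i0s)) big_cons.
Qed.

(** Distinct monomials are distinct characters of the torus, so a polynomial vanishing on it has
    zero coefficients. *)
Lemma mpoly_torus_neq0 n (p : {mpoly F[n]}) : p != 0 ->
  exists x : torus F n, p.@[x] != 0.
Proof.
move=> p0; apply: contrapT => /forallNP px; case/negP: p0.
rewrite -msupp_eq0; case E: (msupp p) => [//|al s]; exfalso.
have al_p : al \in msupp p by rewrite E mem_head.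
move: (al_p); rewrite mcoeff_msupp => /eqP; apply.
apply: (@char_independence n _ (msupp p) (@mrow n) (fun al => p@_al)) => //.
  by move=> be _; apply: contra => /eqP /mrow_inj ->.
by move=> y; rewrite -mevalE_char; apply/eqP; rewrite -[_ == _]negbK; apply/negP/px.
Qed.

Lemma torus_irreducible n : irreducible_set [set: torus F n].
Proof.
move=> U V oU oV [u [_ Uu]] [v [_ Vv]].
have [g [gu gU]] := open_poly oU Uu; have [h [hv hV]] := open_poly oV Vv.
have [|x] := @mpoly_torus_neq0 n (g * h).
  rewrite mulf_neq0//.
    by apply: contra gu => /eqP ->; rewrite meval0.
  by apply: contra hv => /eqP ->; rewrite meval0.
by rewrite mevalM mulf_eq0 negb_or => /andP[/gU Ux /hV Vx]; exists x.
Qed.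

Lemma monomial_image_irreducible p q (A : 'M[int]_(p, q)) (a : torus F p) :
  irreducible_set (range (fun x => tmul a (tmap A x))).
Proof.
by apply: irreducible_image (@torus_irreducible q); apply: monomial_continuous.
Qed.

End TorusIrreducible.

(** * Integer lattices *)

Section IntegerMatrices.

Lemma map_intr_inj p q : injective (map_mx intr : 'M[int]_(p, q) -> 'M[rat]_(p, q)).
Proof.
move=> A B /matrixP AB; apply/matrixP => i j; apply: (@intr_inj rat).
by have := AB i j; rewrite !mxE.
Qed.

Lemma clear_denominators p q (X : 'M[rat]_(p, q)) :
  exists2 N : nat, (0 < N)%N & exists Y : 'M[int]_(p, q),
    N%:R *: X = map_mx intr Y.
Proof.
pose d (ij : 'I_p * 'I_q) := absz (denq (X ij.1 ij.2)).
exists (\prod_ij d ij)%N.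
  by apply: prodn_gt0 => ij; rewrite /d absz_gt0 denq_neq0.
exists (\matrix_(i, j) (numq (X i j) * (\prod_(ij | ij != (i, j)) d ij)%N%:Z)).
apply/matrixP => i j; rewrite !mxE (bigD1 (i, j))//= natrM rmorphM /= numqE.
rewrite [X in X * _ * _](_ : _ = (denq (X i j))%:~R); last first.
  by rewrite /d /= -[RHS](ger0_norm) ?ler0z ?denq_ge0// -intr_norm natr_absz.
by rewrite pmulrn; ring.
Qed.

Lemma intmx_span p q n (A : 'M[int]_(p, n)) (B : 'M[int]_(q, n)) :
    (map_mx intr B <= (map_mx intr A : 'M[rat]_(p, n)))%MS ->
  exists2 N : nat, (0 < N)%N & exists V, N%:Z *: B = V *m A.
Proof.
move=> /submxP[D BDA]; have [N N0 [V NV]] := clear_denominators D.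
exists N => //; exists V; apply: map_intr_inj.
by rewrite map_mxM -NV -scalemxAl -BDA map_mxZ.
Qed.

Lemma intmx_pinv n r (A : 'M[int]_(n, r)) :
  exists2 N : nat, (0 < N)%N & exists X, A *m X *m A = N%:Z *: A.
Proof.
have [N N0 [X NX]] := clear_denominators (pinvmx (map_mx intr A : 'M[rat]_(n, r))).
exists N => //; exists X; apply: map_intr_inj.
by rewrite !map_mxM -NX -scalemxAr -scalemxAl mulmxKpV// map_mxZ.
Qed.

(** With [X] an integral quasi-inverse of [A], the rows of [A *m X - N] annihilate [A], hence [B];
    so [X *m B] is a solution. *)
Lemma intmx_solve n r d (A : 'M[int]_(n, r)) (B : 'M[int]_(n, d)) :
    (forall m : 'rV_n, m *m A = 0 -> m *m B = 0) ->
  exists2 N : nat, (0 < N)%N & exists w, A *m w = N%:Z *: B.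
Proof.
move=> kerAB; have [N N0 [X AXA]] := intmx_pinv A.
exists N => //; exists (X *m B); apply/eqP; rewrite -subr_eq0; apply/eqP/row_matrixP => i.
have := kerAB (row i (A *m X - N%:Z%:M)).
rewrite -!row_mul !mulmxBl !mul_scalar_mx AXA subrr !row0 mulmxA; exact.
Qed.

Section Saturation.
Variables (n : nat) (R : set 'rV[int]_n).

(** Take a finite family in [R] of largest rational rank, which is at most [n]: appending a row
    outside its span would raise the rank. *)
Lemma max_rank_rows : exists p (M : 'M[int]_(p, n)),
  (forall i, R (row i M)) /\
  forall m, R m -> (map_mx intr m <= (map_mx intr M : 'M[rat]_(p, n)))%MS.
Proof.
pose Q k := `[< exists p (M : 'M[int]_(p, n)), (forall i, R (row i M)) /\
  \rank (map_mx intr M : 'M[rat]_(p, n)) = k >].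
have Q0 : exists k, Q k.
  exists 0%N; apply/asboolP; exists 0%N, 0; split; first by case.
  by rewrite map_mx0 mxrank0.
have Qn k : Q k -> (k <= n)%N.
  by move=> /asboolP[p [M [_ <-]]]; rewrite rank_leq_col.
case: (ex_maxnP Q0 Qn) => k /asboolP[p [M [RM rkM]]] kmax.
exists p, M; split=> // m Rm; apply: contraT => mM.
have /kmax : Q (\rank (map_mx intr (col_mx M m) : 'M[rat]_(p + 1, n))).
  apply/asboolP; exists (p + 1)%N, (col_mx M m); split=> // i.
  by case: (split_ordP i) => j ->; rewrite ?rowKu ?rowKd ?ord1 ?row_id.
rewrite leqNgt -rkM map_col_mx rank_ltmx// ltmxE -addsmxE addsmxSl.
by rewrite col_mx_sub submx_refl.
Qed.

(** In the Smith form of [M], the rows of [U] facing nonzero diagonal entries form a basis of the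
    saturation of the lattice spanned by [R]. As [U] is invertible, this basis extends to one of the
    whole lattice. *)
Lemma saturated_basis : exists (U V : 'M[int]_n) (K : {set 'I_n}),
  [/\ U *m V = 1%:M, V *m U = 1%:M,
      forall m k, R m -> k \notin K -> (m *m V) 0 k = 0
    & exists p (M : 'M[int]_(p, n)), (forall i, R (row i M)) /\
      forall k, k \in K -> exists2 e : int, e != 0 &
        exists v, e *: row k U = v *m M].
Proof.
have [p [M [RM spanM]]] := max_rank_rows.
have [L Lu [U Uu [d _ MLDU]]] := int_Smith_normal_form M.
exists U, (invmx U), [set k : 'I_n | [exists i : 'I_p, (i == k :> nat) && (d`_i != 0)]]%SET.
split; rewrite ?mulmxV ?mulVmx//.
  move=> m k Rm kK; have [N N0 [v Nv]] := intmx_span (spanM m Rm).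
  (* Column [k] of the diagonal factor is zero because [k] is outside [K]. *)
  have : N%:Z *: (m *m invmx U) = v *m L *m \matrix_(i, j) (d`_i *+ (i == j :> nat)).
    by rewrite scalemxAl Nv {1}MLDU -!mulmxA mulmxV// mulmx1.
  move/rowP/(_ k); rewrite mxE [RHS]mxE big1 => [/eqP|i _].
    by rewrite mulf_eq0 eqz_nat eqn0Ngt N0 => /eqP.
  rewrite [X in _ * X]mxE; have [ik|] := eqVneq (i : nat) k; last by rewrite mulr0.
  move: kK; rewrite inE negb_exists => /forallP/(_ i); rewrite ik eqxx negbK => /eqP.
  by rewrite -ik => ->; rewrite mulr0.
exists p, M; split=> // k; rewrite inE => /existsP[i /andP[/eqP ik di]].
exists d`_i => //; exists (row i (invmx L)).
rewrite MLDU -!row_mul !mulmxA mulVmx// mul1mx row_mul.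
apply/rowP => j; rewrite !mxE (bigD1 k)//= !mxE ik eqxx mulr1n big1 ?addr0// => l lk.
rewrite !mxE ik (_ : (k == l :> nat) = false) ?mulr0n ?mul0r//.
by apply/negbTE; rewrite eq_sym.
Qed.

End Saturation.
End IntegerMatrices.

(** * Divisibility of the torus *)

Section DivisibleTorus.
Variable F : numClosedFieldType.

Lemma root_exists (e : int) (x : F) : e != 0 -> x != 0 ->
  exists2 y : F, y != 0 & y ^ e = x.
Proof.
move=> e0 x0; have ae0 : (0 < `|e|)%N by rewrite absz_gt0.
have [y0 yx] : `|e|.-root x != 0 /\ `|e|.-root x ^+ `|e| = x.
  by rewrite rootCK// rootC_eq0.
case: (intP e) e0 ae0 y0 yx => // k _ ae0 y0 yx; first by exists (k.+1.-root x).
by exists (k.+1.-root x)^-1; rewrite ?invr_eq0// exprz_inv opprK.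
Qed.

(** Smith form makes the system diagonal. Nonzero entries ask for roots, which exist; a zero row
    asks for a coordinate equal to 1, which the hypothesis on the left kernel supplies. *)
Lemma tmap_solvable n r (A : 'M[int]_(n, r)) (b : torus F n) :
    (forall m, m *m A = 0 -> chareval m b = 1) ->
  exists t : torus F r, tmap A t = b.
Proof.
move=> bker; have [L Lu [U Uu [d _ ALDU]]] := int_Smith_normal_form A.
pose D : 'M[int]_(n, r) := \matrix_(i, j) (d`_i *+ (i == j :> nat)).
pose b' := tmap (invmx L) b.
have /choice[s sP] (j : 'I_r) : exists y : F, y != 0 /\
    forall i : 'I_n, i = j :> nat -> d`_i != 0 -> y ^ d`_i = b' i.
  have [/existsP[i /andP[/eqP ij di]]|] :=
      boolP [exists i : 'I_n, (i == j :> nat) && (d`_i != 0)].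
    have [y y0 yb] := root_exists di (tneq0 b' i).
    by exists y; split=> // k kj _; have -> : k = i by apply/val_inj; rewrite /= kj.
  move=> /existsPn nd; exists 1; split=> [|i ij di]; first exact: oner_neq0.
  by have := nd i; rewrite ij eqxx -ij di.
exists (tmap (invmx U) (tmk s)).
have DsE : tmap D (tmk s) = b'.
  apply: torus_eq => i; rewrite tmapE.
  have [/existsP[j /andP[/eqP ij di]]|/existsPn nd] :=
      boolP [exists j : 'I_r, (i == j :> nat) && (d`_i != 0)].
    rewrite -((sP j).2 i)// -(tmkE (sP j).1) -tmap_scalar tmapE; congr chareval.
    by apply/rowP => k; rewrite !mxE ij.
  have Di0 : row i D = 0.
    apply/rowP => j; rewrite !mxE; have := nd j; case: eqP => //= _.
    by rewrite negbK => /eqP ->; rewrite mul0rn.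
  rewrite Di0 chareval0 /b' tmapE bker// -row_mul {1}ALDU !mulmxA mulVmx// mul1mx.
  by rewrite row_mul Di0 mul0mx.
by rewrite tmapM {1}ALDU mulmxK// -tmapM DsE /b' tmapM mulmxV// tmap1.
Qed.

Lemma troot n (N : nat) (y : torus F n) : (0 < N)%N ->
  exists u : torus F n, tmap N%:Z%:M u = y.
Proof.
move=> N0; apply: tmap_solvable => m; rewrite mul_mx_scalar => /eqP.
by rewrite scalemx_eq0 eqz_nat eqn0Ngt N0 => /eqP ->; rewrite chareval0.
Qed.

End DivisibleTorus.

(** * Transporting layers by translations *)

Section Relations.
Variables (F : numClosedFieldType) (r n : nat) (chi : 'I_n -> 'rV[int]_r).
Implicit Types (a : torus F n) (I J : {set 'I_n}) (t : torus F r).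

(** Rows outside [I] are zeroed, not removed, so that all families share one matrix size;
    [relations] therefore imposes the support condition separately. *)
Definition charmx I : 'M[int]_(n, r) := \matrix_(i < n) (chi i *+ (i \in I)).

Definition relations I : set 'rV[int]_n :=
  [set m : 'rV[int]_n | (forall i, i \notin I -> m 0 i = 0) /\ m *m charmx I = 0].

Lemma row_charmx I i : i \in I -> row i (charmx I) = chi i.
Proof. by move=> iI; rewrite rowK iI mulr1n. Qed.

Lemma rowN_charmx I i : i \notin I -> row i (charmx I) = 0.
Proof. by move=> iI; rewrite rowK (negPf iI) mulr0n. Qed.

Lemma relations_sub I J : I \subset J -> relations I `<=` relations J.
Proof.
move=> /fintype.subsetP IJ m [mI mchi]; split=> [i iJ|].
  by apply: mI; apply: contra iJ; apply: IJ.
rewrite -mchi !mulmx_sum_row; apply: eq_bigr => i _.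
have [iI|iI] := boolP (i \in I); first by rewrite !row_charmx ?IJ.
by rewrite (mI i iI) !scale0r.
Qed.

Lemma relations_mask I (m : 'rV_n) : m *m charmx I = 0 ->
  relations I (\row_i (m 0 i *+ (i \in I))).
Proof.
move=> mA; split=> [i iI|]; first by rewrite mxE (negPf iI).
rewrite -mA !mulmx_sum_row; apply: eq_bigr => i _; rewrite mxE.
by have [iI|iI] := boolP (i \in I); rewrite ?mulr1n// rowN_charmx// !scaler0.
Qed.

Lemma hypertorusE a i t : hypertorus chi a i t <-> chareval (chi i) t = (a i)^-1.
Proof.
rewrite /hypertorus /=; split=> [E|->]; last by rewrite mulfV ?tneq0.
by apply: (mulfI (tneq0 a i)); rewrite E mulfV ?tneq0.
Qed.

Lemma hypertori_inter_neq0 a I :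
  hypertori_inter chi a I !=set0 <-> forall m, relations I m -> chareval m a = 1.
Proof.
split=> [[t tI] m [mI mchi]|rel1].
  have := chareval0 t; rewrite -mchi -chareval_tmap => E.
  rewrite -[LHS]mulr1 -[X in _ * X]E -charevalM /chareval big1// => i _.
  have [iI|iI] := boolP (i \in I); last by rewrite mI// expr0z.
  by rewrite tmulE tmapE row_charmx// tI// exp1rz.
(* The value 1 outside [I] matches the zero rows of [charmx I]. *)
pose b := tmk (fun i => if i \in I then (a i)^-1 else 1).
have bE i : b i = if i \in I then (a i)^-1 else 1.
  by rewrite tmkE//; case: ifP; rewrite ?invr_eq0 ?tneq0 ?oner_neq0.
have [m mA|t tb] := @tmap_solvable F n r (charmx I) b.
  pose m' : 'rV[int]_n := \row_i (m 0 i *+ (i \in I)).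
  have -> : chareval m b = (chareval m' a)^-1.
    rewrite -charevalN; apply: eq_bigr => i _; rewrite !mxE bE.
    by case: ifP; rewrite ?mulr1n ?exprz_inv// mulr0n oppr0 exp1rz expr0z.
  by rewrite rel1 ?invr1//; apply: relations_mask.
exists t => i iI; apply/hypertorusE.
by have := tmapE (charmx I) t i; rewrite tb row_charmx// bE iI.
Qed.

Lemma closed_hypertori_inter_neq0 I :
  closed [set a : torus F n | hypertori_inter chi a I !=set0].
Proof.
rewrite [X in closed X](_ : _ = \bigcap_(m in relations I) [set a : torus F n | chareval m a - 1 = 0]).
  apply: closed_bigI => m _; apply: closed_laurent.
  by apply: laurentD; [apply: laurent_char | apply: laurent_cst].
apply/seteqP; split=> a /=.
  by move=> /hypertori_inter_neq0 rel1 m /rel1 E /=; rewrite E subrr.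
move=> rel1; apply/hypertori_inter_neq0 => m /rel1 /eqP.
by rewrite subr_eq0 => /eqP.
Qed.

(** A layer, being a mere set, does not remember the [I] that defined it; this is the largest
    possible choice. *)
Definition containing a (W : set (torus F r)) : {set 'I_n} :=
  [set i | `[< W `<=` hypertorus chi a i >]]%SET.

Lemma in_containing a W i : i \in containing a W <-> W `<=` hypertorus chi a i.
Proof. by rewrite inE; split=> /asboolP. Qed.

Lemma sub_containing a (W W' : set (torus F r)) :
  W `<=` W' -> containing a W' \subset containing a W.
Proof.
move=> WW'; apply/fintype.subsetP => i /in_containing W'i; apply/in_containing.
exact: subset_trans W'i.
Qed.

Lemma component_containing a I t :
  I \subset containing a (connected_component (hypertori_inter chi a I) t).
Proof.
apply/fintype.subsetP => i iI; apply/in_containing => s.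
by move=> /connected_component_sub /(_ i iI).
Qed.

Lemma containing_inter a W : W `<=` hypertori_inter chi a (containing a W).
Proof. by move=> s Ws i /in_containing; apply. Qed.

Lemma hypertori_interS a I J : I \subset J ->
  hypertori_inter chi a J `<=` hypertori_inter chi a I.
Proof. by move=> /fintype.subsetP IJ t tJ i /IJ; apply: tJ. Qed.

End Relations.

Section Translation.
Variables (F : numClosedFieldType) (r : nat).

Lemma connected_translate (z : torus F r) (A : set (torus F r)) :
  connected A -> connected (tmul z @` A).
Proof.
move=> cA; apply: connected_continuous_connected cA _.
exact/continuous_subspaceT/tmul_continuous.
Qed.

Lemma component_translate (z t : torus F r) (X Y : set (torus F r)) :
    (forall s, X s <-> Y (tmul z s)) -> X t ->
  connected_component Y (tmul z t) = tmul z @` connected_component X t.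
Proof.
move=> XY Xt; apply/seteqP; split; last first.
  apply: connected_component_max.
  - by exists t => //; apply: connected_component_refl.
  - by move=> _ [s /connected_component_sub /XY Ys <-].
  - exact/connected_translate/component_connected.
move=> s cs; exists (tmul (tinv z) s); last by rewrite tmulVK.
have : (tmul (tinv z) @` connected_component Y (tmul z t)) (tmul (tinv z) s) by exists s.
apply: connected_component_max.
- exists (tmul z t); last by rewrite tmulKV.
  by apply: connected_component_refl; apply/XY.
- by move=> _ [p /connected_component_sub Yp <-]; apply/XY; rewrite tmulVK.
- exact/connected_translate/component_connected.
Qed.

End Translation.

Section Transport.
Variables (F : numClosedFieldType) (r n d : nat) (chi : 'I_n -> 'rV[int]_r).
Variable w : {set 'I_n} -> 'M[int]_(r, d).
Variable P : {set 'I_n} -> Prop.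
Hypothesis w_compat : forall I J i, P I -> P J -> i \in I -> i \in J ->
  chi i *m w I = chi i *m w J.

(** Each layer is translated by its own amount; [w_compat] makes these amounts fit together along
    inclusions. *)
Definition shift_layer (a : torus F n) (u : torus F d) (W : set (torus F r)) :=
  tmul (tmap (w (containing chi a W)) u) @` W.

(* The translates of a point by the values of the monomial map [w'] form an
   irreducible subset of the layer. *)
Lemma component_stable (a : torus F n) (I : {set 'I_n}) t (w' : 'M[int]_(r, d)) (u : torus F d) s :
    (forall i, i \in I -> chi i *m w' = 0) ->
    connected_component (hypertori_inter chi a I) t s ->
  connected_component (hypertori_inter chi a I) t (tmul s (tmap w' u)).
Proof.
move=> w'0 ts; rewrite (same_connected_component ts).
have : range (fun v => tmul s (tmap w' v)) (tmul s (tmap w' u)) by exists u.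
apply: connected_component_max.
- exists (tone F d) => //; apply: torus_eq => i; rewrite tmulE tmapE.
  by rewrite /chareval big1 ?mulr1// => j _; rewrite toneE exp1rz.
- move=> _ [v _ <-] i iI; apply/hypertorusE; rewrite charevalM chareval_tmap.
  rewrite w'0// chareval0 mulr1; apply/hypertorusE.
  exact: (connected_component_sub ts).
- exact/irreducible_connected/monomial_image_irreducible.
Qed.

(** The difference of [w J] and [w I] is killed by the [chi i] with [i] in [I], so by
    [component_stable] it moves the component into itself. *)
Lemma shift_component (a : torus F n) (u : torus F d) (I J : {set 'I_n}) t :
    P I -> P J -> I \subset J ->
  tmul (tmap (w J) u) @` connected_component (hypertori_inter chi a I) t =
  tmul (tmap (w I) u) @` connected_component (hypertori_inter chi a I) t.
Proof.
move=> PI PJ /fintype.subsetP IJ.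
have sub (wJ wI : 'M[int]_(r, d)) : (forall i, i \in I -> chi i *m wJ = chi i *m wI) ->
    tmul (tmap wJ u) @` connected_component (hypertori_inter chi a I) t `<=`
    tmul (tmap wI u) @` connected_component (hypertori_inter chi a I) t.
  move=> wE _ [s ts <-]; exists (tmul s (tmap (wJ - wI) u)).
    by apply: component_stable => // i iI; rewrite mulmxBr wE// subrr.
  rewrite tmapB; apply: torus_eq => i; rewrite !tmulE tinvE.
  by rewrite mulrCA [X in _ * X]mulrCA mulfV ?tneq0// mulr1 mulrC.
by apply/seteqP; split; apply: sub => i iI; apply: w_compat => //; apply: IJ.
Qed.

Section Shift.
Variables (a a' : torus F n) (u : torus F d).
Hypothesis neP : forall I, hypertori_inter chi a I !=set0 -> P I.
Hypothesis w_shift : forall I i, P I -> i \in I ->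
  a' i * chareval (chi i) (tmap (w I) u) = a i.

Lemma shift_hypertorus I i t : P I -> i \in I ->
  hypertorus chi a i t <-> hypertorus chi a' i (tmul (tmap (w I) u) t).
Proof.
by move=> PI iI; rewrite /hypertorus /= charevalM mulrA w_shift.
Qed.

Lemma shift_layerE I t :
    hypertori_inter chi a I t ->
  shift_layer a u (connected_component (hypertori_inter chi a I) t) =
  connected_component (hypertori_inter chi a' I) (tmul (tmap (w I) u) t).
Proof.
move=> tI; have PI : P I by apply: neP; exists t.
rewrite /shift_layer shift_component//.
- by apply/esym/component_translate => // s; split=> sI i iI; apply/(shift_hypertorus _ PI iI)/sI.
- apply: neP; exists t; apply: containing_inter; exact: connected_component_refl.
- exact: component_containing.
Qed.

Lemma shift_layers W : layers chi a W -> layers chi a' (shift_layer a u W).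
Proof.
move=> [I [t [tI ->]]]; exists I, (tmul (tmap (w I) u) t); split; last exact: shift_layerE.
have PI : P I by apply: neP; exists t.
by move=> i iI; apply/(shift_hypertorus _ PI iI)/tI.
Qed.

Lemma shift_layer_mono W W' : layers chi a W -> layers chi a W' -> W `<=` W' ->
  shift_layer a u W `<=` shift_layer a u W'.
Proof.
move=> [I [t [tI WE]]] [I' [t' [tI' W'E]]] WW'.
have Wt : W t by rewrite WE; apply: connected_component_refl.
have PW : P (containing chi a W) by apply: neP; exists t; apply: containing_inter.
have PW' : P (containing chi a W').
  by apply: neP; exists t; apply: containing_inter; apply: WW'.
have PI' : P I' by apply: neP; exists t'.
have I'W' : I' \subset containing chi a W' by rewrite W'E; apply: component_containing.
(* Both layers can thus be translated by the matrix attached to the smaller one, [W]. *)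
have E J : P J -> I' \subset J ->
    tmul (tmap (w J) u) @` W' = tmul (tmap (w I') u) @` W'.
  by move=> PJ I'J; rewrite W'E shift_component.
rewrite /shift_layer [X in _ `<=` X]E//.
rewrite -(E (containing chi a W))//; last first.
  exact: fintype.subset_trans I'W' (sub_containing _ _ WW').
exact: image_subset.
Qed.

Lemma shift_layer_hypertorus i : layers chi a (hypertorus chi a i) ->
  shift_layer a u (hypertorus chi a i) = hypertorus chi a' i.
Proof.
move=> [I [t [tI HE]]]; rewrite /shift_layer.
set E := containing _ _ _; have iE : i \in E by apply/in_containing.
have PE : P E.
  apply: neP; exists t; apply: containing_inter; rewrite HE.
  exact: connected_component_refl.
apply/seteqP; split=> [_ [s sH <-]|s sH].
  exact/(shift_hypertorus _ PE iE).
exists (tmul (tinv (tmap (w E) u)) s); last by rewrite tmulVK.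
by apply/(shift_hypertorus _ PE iE); rewrite tmulVK.
Qed.

End Shift.

Lemma shift_layerK (a a' : torus F n) (u : torus F d) W :
    (forall I, hypertori_inter chi a I !=set0 -> P I) ->
    (forall I, hypertori_inter chi a' I !=set0 -> P I) ->
    (forall I i, P I -> i \in I -> a' i * chareval (chi i) (tmap (w I) u) = a i) ->
  layers chi a W -> shift_layer a' (tinv u) (shift_layer a u W) = W.
Proof.
move=> neP neP' w_shift [I [t [tI ->]]]; have PI : P I by apply: neP; exists t.
rewrite (shift_layerE neP w_shift)// (@shift_layerE a' a)//.
- by rewrite tmap_inv tmulKV.
- move=> J i PJ iJ; rewrite tmap_inv chareval_inv.
  by rewrite -(w_shift J i)// mulfK// chareval_neq0.
by move=> i iI; apply/(shift_hypertorus w_shift _ PI iI)/tI.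
Qed.

(** Since [P] holds for the families meeting at [a] and for those meeting at [a'], the same [w] with
    [tinv u] gives the inverse map. *)
Lemma shift_layers_iso (a a' : torus F n) (u : torus F d) (S : posetOver 'I_n) :
    (forall I, hypertori_inter chi a I !=set0 -> P I) ->
    (forall I, hypertori_inter chi a' I !=set0 -> P I) ->
    (forall I i, P I -> i \in I -> a' i * chareval (chi i) (tmap (w I) u) = a i) ->
  layers_iso chi a S -> layers_iso chi a' S.
Proof.
move=> neP neP' w_shift [phi [[phiL phiI phiS] phi_le phi_atom]].
have w_shift' I i : P I -> i \in I -> a i * chareval (chi i) (tmap (w I) (tinv u)) = a' i.
  move=> PI iI; rewrite tmap_inv chareval_inv.
  by rewrite -(w_shift I i)// mulfK// chareval_neq0.
have aL x : layers chi a (phi x) by apply: phiL.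
have K1 W : layers chi a W -> shift_layer a' (tinv u) (shift_layer a u W) = W.
  exact: shift_layerK.
have K2 W : layers chi a' W -> shift_layer a u (shift_layer a' (tinv u) W) = W.
  by have := @shift_layerK a' a (tinv u) W neP' neP w_shift'; rewrite tinvK.
exists (fun x => shift_layer a u (phi x)); split.
- split.
  + by move=> x _; apply: (shift_layers neP w_shift).
  + move=> x y _ _ /(congr1 (shift_layer a' (tinv u))); rewrite !K1// => /phiI.
    by apply; rewrite inE.
  + move=> W WL; have [x _ xW] := phiS _ (shift_layers neP' w_shift' WL).
    by exists x => //=; rewrite xW K2.
- move=> x y; rewrite phi_le; split=> [|xy]; first exact: (shift_layer_mono neP).
  rewrite -[X in X `<=` _]K1// -[X in _ `<=` X]K1//.
  by apply: (shift_layer_mono neP') => //; apply: (shift_layers neP w_shift).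
- move=> i; rewrite phi_atom; apply: (shift_layer_hypertorus neP w_shift).
  by rewrite -phi_atom.
Qed.

End Transport.

(** * Cosets of subtori and strata *)

Section Cosets.
Variables (F : numClosedFieldType) (n : nat) (U V : 'M[int]_n) (K : {set 'I_n}).
Hypotheses (UV : U *m V = 1%:M) (VU : V *m U = 1%:M).

Definition coset (a : torus F n) : set (torus F n) :=
  [set x | forall k, k \in K -> chareval (row k U) x = chareval (row k U) a].

(** Its monomial map parametrises the subtorus on which the characters [row k U], for [k] in [K],
    are trivial. *)
Definition dirmx : 'M[int]_n := \matrix_(i, k) (V i k *+ (k \notin K)).

Lemma mul_dirmx (m : 'rV_n) k : (m *m dirmx) 0 k = (m *m V) 0 k *+ (k \notin K).
Proof.
by rewrite !mxE -sumrMnl; apply: eq_bigr => i _; rewrite mxE mulrnAr.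
Qed.

Lemma dirmx_eq0 (m : 'rV_n) : (forall k, k \notin K -> (m *m V) 0 k = 0) ->
  m *m dirmx = 0.
Proof.
move=> mV; apply/rowP => k; rewrite mul_dirmx [RHS]mxE.
by have [kK|kK] := boolP (k \in K); rewrite /= ?mulr0n// mulr1n mV.
Qed.

Lemma row_dirmx k : k \in K -> row k U *m dirmx = 0.
Proof.
move=> kK; apply: dirmx_eq0 => l lK; rewrite -row_mul UV row1 mxE eqxx /=.
by case: (l =P k) => // lk; move: lK; rewrite lk kK.
Qed.

Lemma coset_range (a : torus F n) :
  coset a = range (fun y => tmul a (tmap dirmx y)).
Proof.
apply/seteqP; split=> [x xa|_ [y _ <-] k kK]; last first.
  by rewrite charevalM chareval_tmap row_dirmx// chareval0 mulr1.
(* In the coordinates given by [U], the quotient of [x] by [a] is 1 at the places in [K], so zeroing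
   those columns of [V] changes nothing. *)
pose h := tmap U (tmul (tinv a) x).
have hK k : k \in K -> h k = 1.
  move=> kK; rewrite tmapE charevalM chareval_inv xa//.
  by rewrite mulVf ?chareval_neq0.
exists h => //; suff -> : tmap dirmx h = tmap V h by rewrite tmapM VU tmap1 tmulVK.
apply: torus_eq => i; rewrite !tmapE; apply: eq_bigr => k _; rewrite !mxE.
by have [/hK ->|] := boolP (k \in K); rewrite ?mulr1n// !exp1rz.
Qed.

Lemma closed_coset a : closed (coset a).
Proof.
rewrite [X in closed X](_ : _ = \bigcap_(k in [set k | k \in K])
  [set x : torus F n | chareval (row k U) x - chareval (row k U) a = 0]).
  apply: closed_bigI => k _; apply: closed_laurent.
  by apply: laurentD; [apply: laurent_char | apply: laurent_cst].
apply/seteqP; split=> x /= xa k kK; first by rewrite /= (xa k kK) subrr.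
by have /eqP := xa k kK; rewrite /= subr_eq0 => /eqP.
Qed.

Lemma coset_irreducible a : irreducible_set (coset a).
Proof. by rewrite coset_range; apply: monomial_image_irreducible. Qed.

End Cosets.

Lemma open_forall (T : topologicalType) (I : finType) (P : I -> set T) :
  (forall i, open (P i)) -> open [set x | forall i, P i x].
Proof.
move=> oP; have oPs (s : seq I) : open [set x | forall i, i \in s -> P i x].
  elim: s => [|i s IHs].
    by rewrite (_ : mkset _ = setT); [apply: openT | apply/seteqP].
  rewrite (_ : mkset _ = P i `&` [set x | forall i, i \in s -> P i x]).
    exact: openI.
  apply/seteqP; split=> x /=.
    move=> Px; split=> [|j js]; first by apply: Px; rewrite mem_head.
    by apply: Px; rewrite inE js orbT.
  by move=> [Pi Ps] j; rewrite inE => /orP[/eqP->//|/Ps].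
rewrite (_ : mkset _ = [set x | forall i, i \in enum I -> P i x]) //.
by apply/seteqP; split=> x Px i; [move=> _|]; apply: Px; rewrite mem_enum.
Qed.

(** * The set L(S) near one of its points *)

Section Stratum.
Variables (F : numClosedFieldType) (r n : nat) (chi : 'I_n -> 'rV[int]_r).
Variable S : posetOver 'I_n.

(** Stated inside [S] alone, so that it does not depend on the point [a]. *)
Definition central (I : {set 'I_n}) : Prop :=
  exists x : S, forall i, i \in I -> (po_atom S i <= x)%O.

Definition poset_relations : set 'rV[int]_n :=
  [set m | exists I, central I /\ relations chi I m].

Lemma centralP (a : torus F n) (I : {set 'I_n}) : layers_iso chi a S ->
  hypertori_inter chi a I !=set0 <-> central I.
Proof.
move=> [phi [[phiL _ phiS] phi_le phi_atom]]; split=> [[t tI]|[x xI]].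
  have [|x _ xE] := phiS (connected_component (hypertori_inter chi a I) t).
    by exists I, t.
  exists x => i iI; apply/phi_le; rewrite phi_atom xE => s.
  by move=> /connected_component_sub /(_ i iI).
have [J [t [tJ xE]]] := phiL x Logic.I; exists t => i /xI /phi_le; rewrite phi_atom; apply.
by rewrite xE; apply: connected_component_refl.
Qed.

Lemma poset_relations1 (a : torus F n) m : layers_iso chi a S ->
  poset_relations m -> chareval m a = 1.
Proof.
by move=> aS [I [/(centralP _ aS) /hypertori_inter_neq0 rel1 mI]]; apply: rel1.
Qed.

(* [w I] solves [chi_I w = - N B_I]; the common factor [N] makes the solutions
   for various [I] agree on the characters they share. *)
Lemma common_solution d (B : 'M[int]_(n, d)) :
    (forall m, poset_relations m -> m *m B = 0) ->
  exists2 N : nat, (0 < N)%N & exists w : {set 'I_n} -> 'M[int]_(r, d),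
    forall I i, central I -> i \in I -> chi i *m w I = - (N%:Z *: row i B).
Proof.
move=> relB; have /choice[Nw NwP] (I : {set 'I_n}) : exists Nw : nat * 'M[int]_(r, d),
    (0 < Nw.1)%N /\
    (central I -> forall i, i \in I -> chi i *m Nw.2 = - (Nw.1%:Z *: row i B)).
  have [cI|ncI] := pselect (central I); last by exists (1%N, 0).
  have [m mA|N N0 [w Aw]] :=
      @intmx_solve n r d (charmx chi I) (\matrix_i (- row i B *+ (i \in I))).
    have : poset_relations (\row_i (m 0 i *+ (i \in I))).
      by exists I; split=> //; apply: relations_mask.
    move=> /relB /(congr1 -%R); rewrite oppr0 => <-.
    rewrite !mulmx_sum_row -sumrN; apply: eq_bigr => i _; rewrite rowK mxE.
    by case: (i \in I); rewrite ?mulr1n ?scalerN// !mulr0n scaler0 scale0r oppr0.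
  exists (N, w); split=> // _ i iI /=.
  have := congr1 (row i) Aw; rewrite row_mul row_charmx// => ->.
  by rewrite linearZ/= rowK iI mulr1n scalerN.
exists (\prod_I (Nw I).1)%N; first by apply: prodn_gt0 => I; have [] := NwP I.
(* Multiplying by the factors of all other index sets brings every solution to the common [N]. *)
exists (fun I => (\prod_(J | J != I) (Nw J).1)%N%:Z *: (Nw I).2) => I i cI iI.
rewrite -scalemxAr (NwP I).2// [in RHS](bigD1 I)//= scalerN scalerA.
by rewrite -PoszM mulnC.
Qed.

(** With [u] an [N]-th root of [y], translating by [w I] at [u] divides [chi i] by exactly the
    factor that multiplies [a i]. *)
Lemma Lset_translate d (B : 'M[int]_(n, d)) (a : torus F n) (y : torus F d) :
    (forall m, poset_relations m -> m *m B = 0) ->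
    Lset F chi S a ->
    (forall I, hypertori_inter chi (tmul a (tmap B y)) I !=set0 -> central I) ->
  Lset F chi S (tmul a (tmap B y)).
Proof.
move=> relB aS neB; have [N N0 [w wP]] := common_solution relB.
have [u uy] := troot y N0.
apply: (@shift_layers_iso F r n d chi w central _ a _ u) => //.
- by move=> I J i cI cJ iI iJ; rewrite !wP.
- by move=> I; apply: (centralP I aS).1.
move=> I i cI iI; rewrite tmulE chareval_tmap wP// charevalN tmapE -uy.
by rewrite chareval_tmap mul_mx_scalar mulfK// chareval_neq0.
Qed.

Definition stratum_open : set (torus F n) :=
  [set x : torus F n | forall I, ~ central I -> ~ (hypertori_inter chi x I !=set0)].

Lemma open_stratum_open : open stratum_open.
Proof.
apply: (@open_forall _ {set 'I_n}
  (fun I => [set x : torus F n | ~ central I -> ~ (hypertori_inter chi x I !=set0)])) => I.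
have [cI|ncI] := pselect (central I).
  rewrite (_ : mkset _ = setT); first exact: openT.
  by apply/seteqP; split=> x // _ /(_ cI).
rewrite (_ : mkset _ = ~` [set x : torus F n | hypertori_inter chi x I !=set0]).
  exact/closed_openC/closed_hypertori_inter_neq0.
by apply/seteqP; split=> x /= => [|? _]; [apply|].
Qed.

Lemma Lset_stratum_open (a : torus F n) : Lset F chi S a -> stratum_open a.
Proof. by move=> aS I ncI /(centralP I aS). Qed.

Variables (U V : 'M[int]_n) (K : {set 'I_n}).
Hypotheses (UV : U *m V = 1%:M) (VU : V *m U = 1%:M).
Hypothesis rel_V : forall m k, poset_relations m -> k \notin K -> (m *m V) 0 k = 0.

Lemma coset_Lset (a x : torus F n) : Lset F chi S a -> coset U K a x ->
  stratum_open x -> Lset F chi S x.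
Proof.
move=> aS; rewrite (coset_range K UV VU) => -[y _ <-] xO.
apply: Lset_translate => // [m rm|I neI].
  by apply: dirmx_eq0 => k; apply: rel_V.
by apply: contrapT => /xO.
Qed.

Variables (p : nat) (M : 'M[int]_(p, n)).
Hypothesis rel_M : forall i, poset_relations (row i M).
Hypothesis M_U : forall k, k \in K ->
  exists2 e : int, e != 0 & exists v, e *: row k U = v *m M.

Lemma Lset_torsion k : k \in K ->
  exists2 e : nat, (0 < e)%N &
    forall b : torus F n, Lset F chi S b -> chareval (row k U) b ^+ e = 1.
Proof.
move=> /M_U[e e0 [v eU]]; exists `|e|%N; first by rewrite absz_gt0.
move=> b bS; have be1 : chareval (row k U) b ^ e = 1.
  rewrite -charevalZ eU mulmx_sum_row chareval_sum big1// => i _.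
  by rewrite charevalZ (poset_relations1 bS)// exp1rz.
case: (intP e) be1 => // j; rewrite -invr_expz => /(congr1 GRing.inv).
by rewrite invrK invr1.
Qed.

Lemma Lset_local_coset (a : torus F n) : Lset F chi S a ->
  exists O : set (torus F n), [/\ open O, O a &
    forall x, O x -> (Lset F chi S x <-> coset U K a x)].
Proof.
move=> aS; have /choice[e eP] k : exists e : nat, (0 < e)%N /\ (k \in K ->
    forall b : torus F n, Lset F chi S b -> chareval (row k U) b ^+ e = 1).
  have [/Lset_torsion[e e0 eP]|] := boolP (k \in K); last by exists 1%N.
  by exists e.
pose z k (x : torus F n) := chareval (row k U) x * (chareval (row k U) a)^-1.
(* On L(S) the ratio [z k] is a root of unity of order dividing [e k]. The cofactor of [z - 1] in
   [z ^+ e - 1] equals [e] at [a]; where it is nonzero the ratio must be 1. *)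
pose O' := [set x : torus F n | forall k, \sum_(j < e k) z k x ^+ j != 0].
exists (stratum_open `&` O'); split.
- apply: openI; first exact: open_stratum_open.
  apply: (@open_forall _ 'I_n (fun k => [set x : torus F n | \sum_(j < e k) z k x ^+ j != 0])).
  move=> k; apply: open_laurent; apply: laurent_sum => j; apply: laurentX.
  by apply: laurentM; [apply: laurent_char | apply: laurent_cst].
- split=> [|k]; first exact: Lset_stratum_open.
  rewrite (eq_bigr (fun=> 1)) => [|j _]; last by rewrite /z mulfV ?chareval_neq0// expr1n.
  by rewrite sumr_const card_ord pnatr_eq0 -lt0n; have [] := eP k.
move=> x [xO xO']; split=> [xS k kK|]; last by move=> xa; exact: coset_Lset aS xa xO.
have /eqP : z k x ^+ e k - 1 = 0.
  by rewrite exprMn exprVn !(eP k).2// invr1 mulr1 subrr.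
rewrite subrX1 mulf_eq0 (negPf (xO' k)) orbF subr_eq0 => /eqP.
by move=> /(canRL (mulfVK (chareval_neq0 _ _))) ->; rewrite mul1r.
Qed.

End Stratum.

(** * Local closedness and smoothness *)

(** Take the union of all good [O]; inside it, the complement of [A] is the union of the open sets
    [O] minus [Z]. *)
Lemma locally_closed_local (T : topologicalType) (A : set T) :
    (forall a, A a -> exists O Z : set T,
      [/\ open O, O a, closed Z & forall x, O x -> (A x <-> Z x)]) ->
  locally_closed A.
Proof.
move=> locA; pose good (O Z : set T) := [/\ open O, closed Z & forall x, O x -> (A x <-> Z x)].
pose D := [set OZ : set T * set T | good OZ.1 OZ.2].
exists (\bigcup_(OZ in D) OZ.1), (~` \bigcup_(OZ in D) (OZ.1 `&` ~` OZ.2)); split.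
- by apply: bigcup_open => -[O Z] [].
- apply: open_closedC; apply: bigcup_open => -[O Z] [oO cZ _].
  exact/openI/closed_openC.
apply/seteqP; split=> x.
  move=> Ax; split=> [|[[O Z] [_ _ /= OZ] [Ox]]]; last by apply; apply/OZ.
  by have [O [Z [oO Ox cZ OZ]]] := locA x Ax; exists (O, Z).
move=> [[[O Z] [oO cZ OZ] /= Ox]] nx; apply/OZ => //; apply: contrapT => nZx.
by apply: nx; exists (O, Z).
Qed.

Section Smooth.
Variables (F : numClosedFieldType) (n : nat) (U V : 'M[int]_n) (K : {set 'I_n}).
Hypotheses (UV : U *m V = 1%:M) (VU : V *m U = 1%:M).
Variables (a : torus F n) (h0 : {mpoly F[n]}).

(** The product of all coordinates: inverting [h] makes every monomial invertible. *)
Let mone : 'X_{1..n} := [multinom 1%N | j < n].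
Let h := h0 * 'X_[mone].
Let idx (k : 'I_#|K|) : 'rV[int]_n := row (enum_val k) U.

Definition coset_eqn (k : 'I_#|K|) : {mpoly F[n]} :=
  'X_[mpos (idx k)] - chareval (idx k) a *: 'X_[mneg (idx k)].

(** The contraction to the polynomial ring of the ideal generated by the [coset_eqn] after inverting
    [h]. *)
Let J (p : {mpoly F[n]}) : Prop :=
  exists (N : nat) (q : 'I_#|K| -> {mpoly F[n]}), h ^+ N * p = \sum_k q k * coset_eqn k.

Let J0 : J 0.
Proof. by exists 0%N, (fun=> 0); rewrite mulr0 big1// => k _; rewrite mul0r. Qed.

Let JM q p : J p -> J (q * p).
Proof.
move=> [N [c E]]; exists N, (fun k => q * c k); rewrite mulrCA E mulr_sumr.
by apply: eq_bigr => k _; rewrite mulrA.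
Qed.

Let JD p q : J p -> J q -> J (p + q).
Proof.
move=> [N [c E]] [N' [c' E']]; exists (N + N')%N, (fun k => h ^+ N' * c k + h ^+ N * c' k).
rewrite mulrDr {1}addnC !exprD -!mulrA E E'.
rewrite !mulr_sumr -big_split.
by apply: eq_bigr => k _; rewrite mulrDl !mulrA.
Qed.

Let JZ c p : J p -> J (c *: p).
Proof. by rewrite -mul_mpolyC; apply: JM. Qed.

Let JB p q : J p -> J q -> J (p - q).
Proof. by move=> Jp Jq; apply: JD => //; rewrite -scaleN1r; apply: JZ. Qed.

Let JX al p : J ('X_[al] * p) -> J p.
Proof.
have [be abE] : exists be : 'X_{1..n}, (be + al)%MM = (mone *+ mdeg al)%MM.
  exists (mone *+ mdeg al - al)%MM; apply: submK; apply/mnm_lepP => j.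
  by rewrite mulmnE mnmE mul1n mdegE (bigD1 j)//= leq_addr.
move=> [N [c E]]; exists (N + mdeg al)%N, (fun k => h0 ^+ mdeg al * 'X_[be] * c k).
rewrite exprD [h ^+ mdeg al]exprMn mpolyXn -abE mpolyXD.
transitivity (h0 ^+ mdeg al * 'X_[be] * (h ^+ N * ('X_[al] * p))); first by ring.
by rewrite E mulr_sumr; apply: eq_bigr => k _; rewrite mulrA.
Qed.

(** The good exponents turn out to form a lattice, so it suffices to check the rows of [U] indexed
    by [K]. One splitting of [m] is enough because monomials cancel in [J]. *)
Let Good (m : 'rV[int]_n) : Prop := forall al be, mrow al - mrow be = m ->
  J ('X_[al] - chareval m a *: 'X_[be]).

Let good_ex (al be : 'X_{1..n}) (m : 'rV[int]_n) : mrow al - mrow be = m ->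
  J ('X_[al] - chareval m a *: 'X_[be]) -> Good m.
Proof.
move=> E Jab al' be' E'; apply: (@JX be).
have abE : (be + al' = al + be')%MM.
  apply: mrow_inj; rewrite !mrowD; move: E; rewrite -E' => /eqP.
  by rewrite subr_eq addrAC eq_sym subr_eq addrC => /eqP.
rewrite mulrBr -scalerAr -!mpolyXD abE addmC [X in _ *: 'X_[X]]addmC.
by rewrite !mpolyXD scalerAr -mulrBr; apply: JM.
Qed.

Let good0 : Good 0.
Proof.
apply: (@good_ex 0%MM 0%MM); first by rewrite subrr.
by rewrite chareval0 scale1r subrr.
Qed.

Let goodB m m' : Good m -> Good m' -> Good (m - m').
Proof.
move=> Gm Gm'; apply: (@good_ex (mpos m + mneg m')%MM (mneg m + mpos m')%MM).
  by rewrite !mrowD -[in RHS](mposBneg m) -[in RHS](mposBneg m') !opprD !opprK addrACA; congr (_ + _); rewrite addrC.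
have := JB (JM 'X_[mneg m'] (Gm _ _ (mposBneg m)))
  (JZ (chareval (m - m') a) (JM 'X_[mneg m] (Gm' _ _ (mposBneg m')))).
congr J; rewrite !mpolyXD charevalD charevalN -!mul_mpolyC !mpolyCM.
have /(congr1 (fun c => c%:MP_[n])) : (chareval m' a)^-1 * chareval m' a = 1.
  by rewrite mulVf ?chareval_neq0.
rewrite mpolyCM; move: ((chareval m' a)^-1%:MP) => z' zz.
(* The last summand isolates the one fact [ring] cannot see, namely that [z'] is inverse to the
   constant [chareval m' a]. *)
transitivity ('X_[mneg m'] * 'X_[mpos m] - (chareval m a)%:MP * z' * ('X_[mneg m] * 'X_[mpos m'])
  + ((z' * (chareval m' a)%:MP) - 1) * (chareval m a)%:MP * 'X_[mneg m] * 'X_[mneg m']).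
  by ring.
by rewrite zz; ring.
Qed.

Let goodN m : Good m -> Good (- m).
Proof. by rewrite -sub0r; apply: goodB. Qed.

Let goodD m m' : Good m -> Good m' -> Good (m + m').
Proof. by move=> Gm Gm'; rewrite -[m']opprK; apply/goodB/goodN. Qed.

Let goodZ (e : int) m : Good m -> Good (e *: m).
Proof.
move=> Gm; have goodn (k : nat) : Good (k%:Z *: m).
  elim: k => [|k IHk]; first by rewrite scale0r.
  by rewrite intS scalerDl scale1r; apply: goodD.
by case: (intP e) => [|k|k]; [apply: (goodn 0%N)|apply: goodn|rewrite scaleNr; apply: goodN].
Qed.

Let good_coset m : (forall k, k \notin K -> (m *m V) 0 k = 0) -> Good m.
Proof.
move=> mV; have -> : m = (m *m V) *m U by rewrite -mulmxA VU mulmx1.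
rewrite mulmx_sum_row; apply: (big_ind Good) => // k _.
have [kK|kK] := boolP (k \in K); last by rewrite mV// scale0r.
apply: goodZ; have {1}-> : row k U = idx (enum_rank_in kK k).
  by rewrite /idx enum_rankK_in.
apply: (@good_ex (mpos _) (mneg _)); first exact: mposBneg.
exists 0%N, (fun l => (l == enum_rank_in kK k)%:R).
rewrite expr0 mul1r (bigD1 (enum_rank_in kK k))//= eqxx mul1r big1 ?addr0//.
by move=> l /negPf ->; rewrite mul0r.
Qed.

Lemma coset_eqnP (x : torus F n) :
  coset U K a x <-> forall k, (coset_eqn k).@[x] = 0.
Proof.
have E k : (coset_eqn k).@[x] = chareval (mrow (mneg (idx k))) x *
    (chareval (idx k) x - chareval (idx k) a).
  rewrite mevalB mevalZ !mevalX_char mulrBr -charevalD mulrC; congr (chareval _ x - _).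
  by apply/eqP; rewrite addrC -subr_eq mposBneg.
split=> [xa k|x0 k kK]; first by rewrite E xa ?subrr ?mulr0// enum_valP.
have /eqP := x0 (enum_rank_in kK k); rewrite E mulf_eq0 (negPf (chareval_neq0 _ _)).
by rewrite subr_eq0 /idx enum_rankK_in// => /eqP.
Qed.

(** Induction on the size of the support. By independence of characters, a monomial [al] of [p]
    restricts to the coset like another monomial [be] of [p], up to a constant. Subtracting a
    multiple of their binomial, which lies in [J], removes [al] and adds no new monomial. *)
Let coset_ideal (p : {mpoly F[n]}) :
  (forall x : torus F n, coset U K a x -> p.@[x] = 0) -> J p.
Proof.
have [N] := ubnP (size (msupp p)); elim: N p => // N IHN p szp p0.
have [->//|pn0] := eqVneq p 0.
have [al alp] : exists al, al \in msupp p.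
  move: pn0; rewrite -msupp_eq0; case: (msupp p) => // al s _.
  by exists al; rewrite mem_head.
have [be [bep beal beD]] : exists be, [/\ be \in msupp p, be != al &
    mrow be *m dirmx V K = mrow al *m dirmx V K].
  apply: contrapT => nobe; move: (alp); rewrite mcoeff_msupp => /eqP; apply.
  suff /eqP : p@_al * chareval (mrow al) a = 0.
    by rewrite mulf_eq0 (negPf (chareval_neq0 _ _)) orbF => /eqP.
  apply: (@char_independence F n _ (msupp p) (fun be => mrow be *m dirmx V K)
    (fun be => p@_be * chareval (mrow be) a)) => //.
    by move=> be bep beal; apply/eqP => E; apply: nobe; exists be.
  move=> y; have : coset U K a (tmul a (tmap (dirmx V K) y)).
    by rewrite (coset_range K UV VU); exists y.
  move=> /p0; rewrite mevalE_char => E; rewrite -[RHS]E; apply: eq_bigr => ga _.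
  by rewrite charevalM chareval_tmap mulrA.
pose m := mrow al - mrow be.
have mD : m *m dirmx V K = 0 by rewrite mulmxBl beD subrr.
have Gm : Good m.
  apply: good_coset => k kK; have := mul_dirmx V K m k.
  by rewrite mD mxE kK mulr1n.
pose b : {mpoly F[n]} := 'X_[al] - chareval m a *: 'X_[be].
have Jb : J b by apply: Gm.
rewrite -[p](subrK (p@_al *: b)); apply: JD; last exact: JZ.
apply: IHN => [|x xa]; last first.
  rewrite mevalB p0// mevalZ /b mevalB mevalZ !mevalX_char.
  have -> : chareval m a = chareval m x.
    move: xa; rewrite (coset_range K UV VU) => -[y _ <-].
    by rewrite charevalM chareval_tmap mD chareval0 mulr1.
  by rewrite -charevalD /m subrK subrr mulr0 subr0.
rewrite -ltnS; apply: leq_trans szp; rewrite ltnS.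
have -> : size (msupp p) = (size (rem al (msupp p))).+1.
  by rewrite size_rem// prednK//; case: (msupp p) alp.
rewrite ltnS; apply: uniq_leq_size; first exact: msupp_uniq.
move=> ga; rewrite mcoeff_msupp /b !(mcoeffB, mcoeffZ) !mcoeffX.
rewrite mem_rem_uniq ?msupp_uniq// !inE.
have [->|gaal] := eqVneq ga al; first by rewrite (negPf beal) mulr0 subr0 mulr1 subrr eqxx.
rewrite sub0r /=.
have [<-|] := eqVneq be ga; first by [].
by rewrite mulr0 oppr0 mulr0 subr0 mcoeff_msupp.
Qed.

Let mderivX_eval (m : 'X_{1..n}) j :
  ('X_[F, m]^`M(j)).@[a] * a j = (m j)%:R * chareval (mrow m) a.
Proof.
rewrite mderivX mevalZ -mulrA; have [->|mj] := eqVneq (m j) 0%N; first by rewrite !mul0r.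
congr (_ * _); rewrite -[a j]mevalXU -mevalM -mpolyXD submK ?mevalX_char//.
by apply/mnm_lepP => i; rewrite mnm1E; case: eqP => // <-; rewrite lt0n.
Qed.

(** After multiplying column [j] by [a j], row [k] becomes a row of [U] times the unit [c k];
    columns of [V] then provide a right inverse. *)
Let coset_jacobian :
  row_free (\matrix_(k < #|K|, j < n) ((coset_eqn k)^`M(j)).@[a]).
Proof.
pose c k := chareval (mrow (mpos (idx k))) a.
have c0 k : c k != 0 by apply: chareval_neq0.
have dE k j : ((coset_eqn k)^`M(j)).@[a] * a j = c k * (idx k 0 j)%:~R.
  rewrite mderivB mderivZ mevalB mevalZ mulrBl -mulrA !mderivX_eval.
  rewrite mulrCA -charevalD.
  have -> : idx k + mrow (mneg (idx k)) = mrow (mpos (idx k)).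
    by apply/esym/eqP; rewrite -subr_eq mposBneg.
  have -> : idx k 0 j = (mpos (idx k) j)%:Z - (mneg (idx k) j)%:Z.
    by rewrite -{1}(mposBneg (idx k)) [LHS]mxE [X in X + _]mxE [X in _ + X]mxE [X in - X]mxE.
  by rewrite -mulrBl mulrC rmorphB /= -!pmulrn.
apply/row_freeP; exists (\matrix_(j, l) (a j * (V j (enum_val l))%:~R / c l)).
apply/matrixP => k l; rewrite !mxE.
under eq_bigr do rewrite !mxE !mulrA dE.
transitivity (c k * ((U *m V) (enum_val k) (enum_val l))%:~R / c l).
  rewrite mxE rmorph_sum mulr_sumr mulr_suml; apply: eq_bigr => j _.
  by rewrite /idx mxE rmorphM !mulrA.
rewrite UV mxE (inj_eq enum_val_inj); have [->|] := eqVneq k l.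
  by rewrite mulr1 mulfV.
by rewrite mulr0 mul0r.
Qed.

Lemma smooth_at_coset (X : set (torus F n)) : h0.@[a] != 0 ->
  (forall x : torus F n, h0.@[x] != 0 -> (X x <-> coset U K a x)) -> smooth_at X a.
Proof.
move=> h0a h0X; exists h, #|K|, coset_eqn.
have hx (x : torus F n) : (h.@[x] != 0) = (h0.@[x] != 0).
  by rewrite mevalM mulf_eq0 mevalX_char (negPf (chareval_neq0 _ _)) orbF.
split; rewrite ?hx//.
- by move=> x; rewrite hx => /h0X ->; apply: coset_eqnP.
(* The factor [h] extends the vanishing of [p] to the whole coset, at the price of one more power of
   [h]. *)
- move=> p pX; have [x xa|N [q E]] := @coset_ideal (h * p).
    have [hx0|hxn0] := eqVneq (h.@[x]) 0; first by rewrite mevalM hx0 mul0r.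
    by rewrite mevalM pX ?mulr0//; apply/h0X => //; rewrite -hx.
  by exists N.+1, q; rewrite exprSr -mulrA.
Qed.

End Smooth.

(** * Ranks and nearly generic posets *)

Section Rank.
Variables (F : numClosedFieldType) (r n : nat) (chi : 'I_n -> 'rV[int]_r).
Implicit Types (a : torus F n) (I J : {set 'I_n}) (t : torus F r).

Let qmx I : 'M[rat]_(n, r) := map_mx intr (charmx chi I).

Definition char_rank I : nat := \rank (qmx I).

Let row_qmx I i : row i (qmx I) = map_mx intr (row i (charmx chi I)).
Proof. by rewrite map_row. Qed.

Let qmxS I J : I \subset J -> (qmx I <= qmx J)%MS.
Proof.
move=> /fintype.subsetP IJ; apply/row_subP => i; have [iI|iI] := boolP (i \in I).
  by rewrite row_qmx row_charmx// -(row_charmx chi (IJ i iI)) -row_qmx row_sub.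
by rewrite row_qmx rowN_charmx// map_mx0 sub0mx.
Qed.

Let char_rank_card I : (char_rank I <= #|I|)%N.
Proof.
have sub : (qmx I <= (\matrix_(k < #|I|) row (enum_val k) (qmx I)))%MS.
  apply/row_subP => i; have [iI|iI] := boolP (i \in I); last first.
    by rewrite row_qmx rowN_charmx// map_mx0 sub0mx.
  rewrite -{1}(enum_rankK_in iI iI).
  rewrite -[X in (X <= _)%MS](rowK (fun k : 'I_#|I| => row (enum_val k) (qmx I))).
  exact: row_sub.
exact: leq_trans (mxrankS sub) (rank_leq_row _).
Qed.

(** A character with nonzero coefficient in [m] is a rational combination of the others, so dropping
    it keeps the rank. *)
Lemma char_rank_dependent I m : relations chi I m -> m != 0 ->
  (char_rank I < #|I|)%N.
Proof.
move=> [mI mA] /eqP m0.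
have /existsNP[i0 /eqP mi0] : ~ forall i, m 0 i = 0.
  by move=> mE; apply: m0; apply/rowP => i; rewrite mE mxE.
have i0I : i0 \in I by apply: contraR mi0 => /mI ->.
rewrite (cardsD1 i0) i0I ltnS; apply: leq_trans (char_rank_card (I :\ i0)).
apply: mxrankS; apply/row_subP => i.
have [->|ii0] := eqVneq i i0; last first.
  have [iI|iI] := boolP (i \in I); last first.
    by rewrite row_qmx rowN_charmx// map_mx0 sub0mx.
  have iI0 : i \in I :\ i0 by rewrite !inE ii0.
  by rewrite row_qmx row_charmx// -(row_charmx chi iI0) -row_qmx row_sub.
have mE : m *m charmx chi (I :\ i0) = - (m 0 i0 *: chi i0).
  apply/eqP; rewrite -addr_eq0 -mA !mulmx_sum_row (bigD1 i0)//=.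
  rewrite rowN_charmx ?inE ?eqxx// scaler0 add0r [X in _ == X](bigD1 i0)//=.
  rewrite row_charmx// addrC eq_sym; apply/eqP; congr (_ + _).
  apply: eq_bigr => j ji0; have [jI|jI] := boolP (j \in I).
    by rewrite !row_charmx// !inE ji0.
  by rewrite mI// !scale0r.
rewrite row_qmx row_charmx//.
have -> : map_mx intr (chi i0) = (- (m 0 i0)%:~R^-1) *: (map_mx intr m *m qmx (I :\ i0)) :> 'rV[rat]_r.
  rewrite -map_mxM mE map_mxN map_mxZ scalerN scaleNr opprK scalerA.
  by rewrite mulVf ?scale1r// intr_eq0.
by rewrite scalemx_sub// submxMl.
Qed.

(** If the ranks agreed, a multiple of each [chi i] with [i] in [containing chi a X] would be
    constant on [Y]. Then [chi i] itself is constant on the connected set [Y], which forces [Y] into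
    [X]. *)
Lemma char_rank_layer a (X Y : set (torus F r)) : layers chi a X -> layers chi a Y ->
    X `<=` Y -> ~ Y `<=` X ->
  (char_rank (containing chi a Y) < char_rank (containing chi a X))%N.
Proof.
move=> [I [t [tI XE]]] [I' [t' [tI' YE]]] XY YX.
have EYX := sub_containing chi a XY; rewrite ltnNge; apply/negP => rkXY; apply: YX.
have Xt : X t by rewrite XE; apply: connected_component_refl.
have cY : connected Y by rewrite YE; apply: component_connected.
have spanXY : (qmx (containing chi a X) <= qmx (containing chi a Y))%MS.
  by rewrite -(geq_leqif (mxrank_leqif_sup (qmxS EYX))).
have [N N0 [v Nv]] := intmx_span spanXY.
suff YI : Y `<=` hypertori_inter chi a (containing chi a X).
  rewrite XE; apply: connected_component_max => //; first exact: XY.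
  apply: subset_trans YI _; apply: hypertori_interS.
  by rewrite XE component_containing.
move=> s Ys i iX.
pose phi (p : torus F r) := chareval (chi i) p * (chareval (chi i) t)^-1.
have phiN p : Y p -> phi p ^+ N = 1.
  move=> Yp; rewrite /phi -chareval_inv -charevalM.
  have := congr1 (row i) Nv; rewrite linearZ/= row_charmx// row_mul => NE.
  have -> : chareval (chi i) (tmul p (tinv t)) ^+ N =
    chareval (N%:Z *: chi i) (tmul p (tinv t)) by rewrite charevalZ.
  rewrite NE mulmx_sum_row chareval_sum big1// => j _; rewrite charevalZ.
  have [jY|jY] := boolP (j \in containing chi a Y); last first.
    by rewrite rowN_charmx// chareval0 exp1rz.
  have jH := (in_containing chi a Y j).1 jY.
  rewrite row_charmx// charevalM chareval_inv.
  rewrite ((hypertorusE chi a j p).1 (jH _ Yp)) ((hypertorusE chi a j t).1 (jH _ (XY _ Xt))).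
  by rewrite mulfV ?exp1rz// invr_eq0 tneq0.
have phit : phi t = 1 by rewrite /phi mulfV ?chareval_neq0.
have phiL : laurent phi by apply: laurentM; [apply: laurent_char|apply: laurent_cst].
(* The locus [phi = 1] is clopen in [Y]: it is also where the cofactor of [phi - 1] in
   [phi ^+ N - 1] does not vanish. *)
have Y1 : Y `&` [set p | phi p - 1 = 0] = Y.
  apply: cY; first by exists t; split=> /=; [apply: XY|rewrite phit subrr].
    exists [set p | \sum_(j < N) phi p ^+ j != 0].
      by apply: open_laurent; apply: laurent_sum => j; apply: laurentX.
    apply/seteqP; split=> p [Yp]/= pE; split=> //=.
      have -> : phi p = 1 by apply/eqP; rewrite -subr_eq0 pE.
      rewrite (eq_bigr (fun=> 1)) => [|j _]; last by rewrite expr1n.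
      by rewrite sumr_const card_ord pnatr_eq0 -lt0n.
    have /eqP : phi p ^+ N - 1 = 0 by rewrite phiN// subrr.
    by rewrite subrX1 mulf_eq0 (negPf pE) orbF => /eqP.
  exists [set p | phi p - 1 = 0] => //; apply: closed_laurent.
  by apply: laurentD => //; apply: laurent_cst.
have : (Y `&` [set p | phi p - 1 = 0]) s by rewrite Y1.
move=> [_ /= /eqP]; rewrite subr_eq0 => /eqP.
move=> /(canRL (mulfVK (chareval_neq0 _ _))); rewrite mul1r => sE.
by apply/hypertorusE; rewrite sE; apply/hypertorusE; move: iX => /in_containing; apply.
Qed.

End Rank.

Section NearlyGeneric.
Variables (F : numClosedFieldType) (r n : nat) (chi : 'I_n -> 'rV[int]_r).
Variables (S : posetOver 'I_n) (a : torus F n).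
Hypothesis aS : layers_iso chi a S.

Let atoms_below (x : S) : {set 'I_n} := [set i | (po_atom S i <= x)%O]%SET.

(* An element below [x] of maximal character rank is covered by [x], so
   [po_rank_cover] gives the induction step. *)
Lemma po_rank_le_char_rank (x : S) : (po_rank x <= char_rank chi (atoms_below x))%N.
Proof.
have [phi [[phiL phiI phiS] phi_le phi_atom]] := aS.
have belowE y : atoms_below y = containing chi a (phi y).
  apply/setP => i; rewrite inE; apply/idP/idP => [iy|/in_containing].
    by apply/in_containing; rewrite -phi_atom; apply/phi_le.
  by rewrite -phi_atom => /phi_le.
have rk_lt (y z : S) : (y < z)%O ->
    (char_rank chi (atoms_below y) < char_rank chi (atoms_below z))%N.
  move=> yz; rewrite !belowE; apply: char_rank_layer; [exact: phiL|exact: phiL| |].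
    by apply/phi_le/ltW.
  by move=> /phi_le zy; have := lt_le_trans yz zy; rewrite ltxx.
have [k] := ubnP (char_rank chi (atoms_below x)); elim: k x => // k IHk x rkx.
have [/existsNP[y0 /negP/negPn y0x]|min_x] :=
    pselect (~ forall y, ~~ (y < x)%O); last first.
  by rewrite po_rank_min//; apply: contrapT.
pose Q j := `[< exists2 y : S, (y < x)%O & char_rank chi (atoms_below y) = j >].
have Q0 : exists j, Q j by exists (char_rank chi (atoms_below y0)); apply/asboolP; exists y0.
have Qb j : Q j -> (j <= char_rank chi (atoms_below x))%N.
  by move=> /asboolP[y yx <-]; apply/ltnW/rk_lt.
case: (ex_maxnP Q0 Qb) => j /asboolP[y yx <-] ymax.
rewrite (po_rank_cover yx).
  by apply: leq_ltn_trans (IHk y _) (rk_lt _ _ yx); apply: leq_trans (rk_lt _ _ yx) _.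
move=> z; apply/negP => /andP[yz zx].
have /ymax : Q (char_rank chi (atoms_below z)) by apply/asboolP; exists z.
by rewrite leqNgt rk_lt.
Qed.

(** A nonzero relation among the atoms below [x] makes them outnumber [char_rank], hence
    [po_rank x]; so [x] is not generic and lies below [Wbar]. *)
Lemma poset_relations_supp (Wbar : S) m :
    (forall W : S, ~~ (W <= Wbar)%O -> generic_layer W) ->
  poset_relations chi S m -> relations chi (atoms_below Wbar) m.
Proof.
move=> Wgen [I [[x xI] mI]].
have [->|m0] := eqVneq m 0; first by split=> [i _|]; rewrite ?mxE// mul0mx.
have Ix : I \subset atoms_below x by apply/fintype.subsetP => i /xI; rewrite inE.
have mx := relations_sub Ix mI.
have xW : (x <= Wbar)%O.
  apply: contraT => /Wgen; rewrite /generic_layer => card_x.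
  have := leq_trans (char_rank_dependent mx m0) (eq_leq card_x).
  by rewrite ltnNge po_rank_le_char_rank.
apply: relations_sub mx; apply/fintype.subsetP => i; rewrite !inE => ix.
exact: le_trans ix xW.
Qed.

End NearlyGeneric.

(** * Local closedness, smoothness and connectedness of L(S) *)

Unset Implicit Arguments.

Theorem theorem8p3 (R : realType) (r n : nat) (chi : 'I_n -> 'rV[int]_r)
    (S : posetOver 'I_n) :
  (forall i, primitive_char (chi i)) ->
  [/\ locally_closed (Lset R[i] chi S),
      smooth_subset (Lset R[i] chi S)
    & nearly_generic S ->
        connected (Lset R[i] chi S) \/
        Lset R[i] chi S = set0].
Proof.
move=> _.
have [U [V [K [UV VU rel_V [p [M [rel_M M_U]]]]]]] := saturated_basis (poset_relations chi S).
have local := @Lset_local_coset R[i] r n chi S U V K UV VU rel_V p M rel_M M_U.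
split.
- apply: locally_closed_local => a aS; have [O [oO Oa Oloc]] := local a aS.
  by exists O, (coset U K a); split=> //; apply: closed_coset.
- move=> a aS; have [O [oO Oa Oloc]] := local a aS.
  have [h [ha hO]] := open_poly oO Oa.
  by apply: (smooth_at_coset UV VU ha) => x hx; exact: Oloc x (hO x hx).
move=> [Wbar Wgen].
have [[a aS]|L0] := pselect (Lset R[i] chi S !=set0); last first.
  by right; apply/seteqP; split=> // x xS; apply: L0; exists x.
left; suff -> : Lset R[i] chi S = coset U K a `&` stratum_open chi S.
  apply/irreducible_connected/irreducible_setI; last exact: open_stratum_open.
  exact: (@coset_irreducible R[i] n U V K UV VU a).
apply/seteqP; split=> x; last by move=> [xa xO]; exact: (coset_Lset UV VU rel_V aS xa xO).
move=> xS; split; last exact: Lset_stratum_open.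
move=> k kK; have [e e0 [v eU]] := M_U k kK.
pose E : {set 'I_n} := [set i | (po_atom S i <= Wbar)%O]%SET.
(* A nonzero multiple of [row k U] is a relation on the central family [E], and such relations are
   saturated. So [row k U] takes the value 1 on all of L(S), not merely a root of unity. *)
have relU : relations chi E (row k U).
  have [eU0 eUchi] : relations chi E (e *: row k U).
    rewrite eU mulmx_sum_row; apply: (big_ind (relations chi E)).
    - by split=> [i _|]; rewrite ?mxE// mul0mx.
    - move=> m m' [m0 mA] [m0' mA']; split=> [i iE|]; last by rewrite mulmxDl mA mA' addr0.
      by rewrite mxE m0// m0'// addr0.
    - move=> i _; have [m0 mA] := poset_relations_supp aS Wgen (rel_M i).
      by split=> [j jE|]; [rewrite mxE m0// mulr0|rewrite -scalemxAl mA scaler0].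
  split=> [i /eU0 /eqP|]; first by rewrite mxE mulf_eq0 (negPf e0) => /eqP.
  by move/eqP: eUchi; rewrite -scalemxAl scalemx_eq0 (negPf e0) => /eqP.
have cE : poset_relations chi S (row k U).
  by exists E; split=> //; exists Wbar => i; rewrite inE.
by rewrite !(poset_relations1 _ cE).
Qed.
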